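(* Let $y$ be an algebraic function of $N$ complex variables $x_1,\dots,x_N$ whose monodromy group is solvable. Then $y$ can be represented by rational functions of $x_1,\dots,x_N$ by root extractions and summations.
   Context: An algebraic function $y(x)$ of $x=(x_1,\dots,x_N)$ is the multivalued function defined by an irreducible equation $P_n y^n+\dots+P_0=0$ over $\mathbb{C}(x_1,\dots,x_N)$, with $P_i$ complex polynomials in $x$ and $P_n\not\equiv0$. Let $J$ be the discriminant of the equation and $\Sigma=\{P_nJ=0\}\subset\mathbb{C}^N$. At $x_0\in\mathbb{C}^N\setminus\Sigma$ the function $y$ has exactly $n$ germs $y_1,\dots,y_n$ (the germs of analytic functions satisfying the equation). The monodromy group of $y$ is the group of all permutations of $\{y_1,\dots,y_n\}$ induced by analytic continuation along loops in $\mathbb{C}^N\setminus\Sigma$ based at $x_0$; up to isomorphism it does not depend on $x_0$. Representability: $y$ is represented by rational functions by root extractions and summations if there are a point $a\in\mathbb{C}^N$ and a finite sequence $g_1,\dots,g_k$ of germs of analytic functions at $a$ such that $g_k$ is a germ of $y$ at $a$ and each $g_i$ either is a germ of a rational function of $x_1,\dots,x_N$, or is a sum $g_j+g_l$ with $j,l<i$, or satisfies $g_i^q=g_j$ for some $j<i$ and some integer $q\ge1$. *)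

(* Defs.v *)
From HB Require Import structures.
From mathcomp Require Import all_boot all_order all_algebra all_fingroup all_solvable.
From mathcomp Require Import all_classical all_reals all_analysis.
From mathcomp Require Import fraction mxpoly polydiv complex zify lra.
(* The notations of mpoly clash with those of MathComp-Analysis;
   [mpoly N A] is the ring of polynomials in N variables over A. *)
From mathcomp Require Import -(notations) mpoly.

Set Implicit Arguments.
Unset Strict Implicit.
Unset Printing Implicit Defensive.

Import Order.TTheory GRing.Theory Num.Theory.
Import numFieldNormedType.Exports.

Local Open Scope classical_set_scope.
Local Open Scope ring_scope.

Section Discriminant.
Variable A : idomainType.
Implicit Types P : {poly A}.

(* J = (-1)^(n(n-1)/2) Res(P, P') / P_n, where n is the degree of P and P_n its
   leading coefficient; this quotient is exact, see discriminantE. *)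
Definition discriminant P : A :=
  xget 0 [set J | lead_coef P * J =
                  (-1) ^+ 'C((size P).-1, 2) * resultant P P^`()].

Lemma discriminantE P : [pchar A] =i pred0 -> (1 < size P)%N ->
  lead_coef P * discriminant P =
    (-1) ^+ 'C((size P).-1, 2) * resultant P P^`().
Proof.
move=> pcharA sP; rewrite /discriminant; case: xgetP => [J _ //|].
suff [J JE] : exists J, resultant P P^`() = lead_coef P * J.
  by move=> /(_ ((-1) ^+ 'C((size P).-1, 2) * J)) []; rewrite /= JE mulrCA.
set n := (size P).-1.
have nE : n.+1 = size P by rewrite prednK // (leq_trans _ sP).
have n_gt0 : (0 < n)%N by rewrite -ltnS nE.
have sP' : (size P^`()).-1 = n.-1.
  suff -> : size P^`() = n by [].
  apply/eqP; rewrite eqn_leq; apply/andP; split.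
    by rewrite -ltnS nE lt_size_deriv // -size_poly_eq0 -nE.
  rewrite -(prednK n_gt0) ltnNge; apply/negP => /leq_sizeP/(_ _ (leqnn _))/eqP.
  apply/negP; rewrite coef_deriv prednK // -mulr_natr mulf_neq0 //.
    by rewrite -/(lead_coef P) lead_coef_eq0 -size_poly_eq0 -nE.
  by rewrite (pcharf0P _).1 // -lt0n.
have j_lt : ((n.-1 + n).-1 < (size P^`()).-1 + (size P).-1)%N by lia.
pose j := Ordinal j_lt.
have dvdS i : exists w, Sylvester_mx P P^`() i j = lead_coef P * w.
  rewrite Sylvester_mxE /=; case: (fintype.split i) => k; have k_lt := ltn_ord k.
    case: (k <= _)%N; last by exists 0; rewrite mulr0n mulr0.
    have {}k_lt : (k < n.-1)%N by apply: leq_trans k_lt _; rewrite sP'.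
    have : (n <= (n.-1 + n).-1 - k)%N by move: (nat_of_ord k) k_lt n_gt0; clear; lia.
    rewrite leq_eqVlt => /orP[/eqP <-|lt]; first by exists 1; rewrite mulr1.
    by exists 0; rewrite mulr0 nth_default //; apply: leq_trans lt; rewrite nE.
  case: (k <= _)%N; last by exists 0; rewrite mulr0n mulr0.
  rewrite mulr1n coef_deriv.
  have {}k_lt : (k < n)%N := k_lt.
  have : (n <= ((n.-1 + n).-1 - k).+1)%N by move: (nat_of_ord k) k_lt n_gt0; clear; lia.
  rewrite leq_eqVlt => /orP[/eqP <-|lt]; first by exists n%:R; rewrite mulr_natr.
  by exists 0; rewrite mulr0 nth_default ?mul0rn //; apply: leq_trans lt; rewrite nE.
have [w wE] := choice dvdS.
exists (\sum_i w i * cofactor (Sylvester_mx P P^`()) i j).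
rewrite /resultant (expand_det_col _ j).
by rewrite mulr_sumr; apply: eq_bigr => i _; rewrite wE mulrA.
Qed.

End Discriminant.

(* The complex numbers R[i]; at this type they inherit the topology and the
   normed module structure that MathComp-Analysis puts on every numFieldType. *)
Definition Cplx (R : realType) : numClosedFieldType := R[i].

Section AlgebraicFunction.
Variables (R : realType) (N : nat).
Local Notation C := (Cplx R).
Local Notation CN := 'rV[C]_N.

(* A germ at a is given by a function CN -> C, taken up to germ_eq a. *)
Definition germ_eq (a : CN) (f g : CN -> C) : Prop :=
  \forall x \near a, f x = g x.

(* [differentiable] is here Frechet differentiability over the field C, so that
   f is a holomorphic function of N complex variables near a. *)
Definition analytic_at (a : CN) (f : CN -> C) : Prop :=
  \forall x \near a, differentiable f x.

Definition rational_germ (a : CN) (f : CN -> C) : Prop :=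
  exists p q : mpoly N C, meval (a 0) q != 0 /\
    germ_eq a f (fun x => meval (x 0) p / meval (x 0) q).

(* P = P_n y^n + ... + P_0, with coefficients P_i in C[x_1, ..., x_N]. *)
Variable P : {poly mpoly N C}.

Definition algebraic_equation : Prop :=
  irreducible_poly (map_poly (@tofrac (mpoly N C)) P).

Definition equation_at (x : CN) : {poly C} := map_poly (meval (x 0)) P.

Definition germ_of_y (a : CN) (f : CN -> C) : Prop :=
  analytic_at a f /\ \forall x \near a, (equation_at x).[f x] = 0.

Definition Sigma : set CN :=
  [set x | meval (x 0) (lead_coef P * discriminant P) = 0].

Local Notation degree := (size P).-1.

Definition all_germs (x0 : CN) (Y : 'I_degree -> CN -> C) : Prop :=
  [/\ forall i, germ_of_y x0 (Y i),
      forall i j, germ_eq x0 (Y i) (Y j) -> i = j &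
      forall f, germ_of_y x0 f -> exists i, germ_eq x0 f (Y i)].

Definition loop_at (x0 : CN) (gamma : R -> CN) : Prop :=
  [/\ {within `[0, 1], continuous gamma}, gamma 0 = x0, gamma 1 = x0 &
      forall t : R, 0 <= t <= 1 -> ~ Sigma (gamma t)].

(* F t represents the germ at gamma t; near t all germs F s are germs of the
   single function F t. *)
Definition continues_to (gamma : R -> CN) (f g : CN -> C) : Prop :=
  exists F : R -> CN -> C,
    [/\ forall t : R, 0 <= t <= 1 -> analytic_at (gamma t) (F t),
        germ_eq (gamma 0) (F 0) f,
        germ_eq (gamma 1) (F 1) g &
        forall t : R, 0 <= t <= 1 -> \forall s \near t, 0 <= s <= 1 ->
          germ_eq (gamma s) (F s) (F t)].

(* Permutations of the germs Y i, i.e. of their indices; see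
   monodromy_group_set for the group property. *)
Definition monodromy (x0 : CN) (Y : 'I_degree -> CN -> C) : {set 'S_degree} :=
  [set s : 'S_degree | `[< exists gamma, loop_at x0 gamma /\
                 forall i, continues_to gamma (Y i) (Y (s i)) >]]%SET.

Definition representable_by_radicals : Prop :=
  exists (a : CN) (k : nat) (g : 'I_k.+1 -> CN -> C),
    (forall i, analytic_at a (g i) /\
      [\/ rational_germ a (g i),
          exists j l : 'I_k.+1, [/\ (j < i)%N, (l < i)%N &
            germ_eq a (g i) (fun x => g j x + g l x)] |
          exists (j : 'I_k.+1) (q : nat), [/\ (j < i)%N, (1 <= q)%N &
            germ_eq a (fun x => g i x ^+ q) (g j)]]) /\
    germ_of_y a (g ord_max).

Let concat (gamma1 gamma2 : R -> CN) (t : R) : CN :=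
  if t <= 2^-1 then gamma1 (2 * t) else gamma2 (2 * t - 1).

Let cont2 : continuous (fun t : R => 2 * t).
Proof. by move=> t; apply: cvgM; [exact: cvg_cst | exact: cvg_id]. Qed.

Let cont21 : continuous (fun t : R => 2 * t - 1).
Proof. by move=> t; apply: cvgB; [exact: cont2 | exact: cvg_cst]. Qed.

Let germ_eq_refl a f : germ_eq a f f.
Proof. by apply: (@filterE _ (nbhs a)). Qed.

Let germ_eq_sym a f g : germ_eq a f g -> germ_eq a g f.
Proof. by apply: filterS => x ->. Qed.

Let germ_eq_trans a f g h : germ_eq a f g -> germ_eq a g h -> germ_eq a f h.
Proof. by move=> fg gh; apply: filterS2 fg gh => x -> ->. Qed.

Let loop_concat x0 gamma1 gamma2 : loop_at x0 gamma1 -> loop_at x0 gamma2 ->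
  loop_at x0 (concat gamma1 gamma2).
Proof.
move=> [c1 g10 g11 S1] [c2 g20 g21 S2]; split.
- have -> : `[0, 1]%classic = `[0, 2^-1] `|` `[2^-1, 1] :> set R.
    apply/seteqP; split => t /=; rewrite !in_itv /=; last by case=> ?; lra.
    by move=> ?; case: (leP t 2^-1) => ?; [left|right]; lra.
  apply: withinU_continuous; [exact: interval_closed|exact: interval_closed| |].
  + apply/subspace_continuousP => t /=; rewrite in_itv /= => t01.
    have t01' : `[0, 1]%classic (2 * t) by rewrite /= in_itv /=; lra.
    move/subspace_continuousP : c1 => /(_ _ t01') c1 B.
    have cE u : u <= 2^-1 -> concat gamma1 gamma2 u = gamma1 (2 * u).
      by rewrite /concat => ->.
    rewrite /from_subspace cE; last lra.
    move=> /c1 H; have {H} : \forall u \near 2 * t, `[0, 1]%classic u -> B (gamma1 u).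
      exact: H.
    move=> H; have {}H : \forall s \near t, `[0, 1]%classic (2 * s) -> B (gamma1 (2 * s)).
      exact: (cont2 (x := t) H).
    have : \forall s \near t, _ := H; apply: filterS => {}s {}H.
    by rewrite /= in_itv /= => s01; rewrite cE; [apply: H; rewrite /= in_itv /=|]; lra.
  + apply/subspace_continuousP => t /=; rewrite in_itv /= => t01.
    have t01' : `[0, 1]%classic (2 * t - 1) by rewrite /= in_itv /=; lra.
    move/subspace_continuousP : c2 => /(_ _ t01') c2 B.
    have cE u : 2^-1 <= u -> concat gamma1 gamma2 u = gamma2 (2 * u - 1).
      rewrite /concat => u2; case: ifPn => // u2'.
      have -> : u = 2^-1 by lra.
      by rewrite mulfV // subrr g11 g20.
    rewrite /from_subspace cE; last lra.
    move=> /c2 H; have {H} : \forall u \near 2 * t - 1, `[0, 1]%classic u -> B (gamma2 u).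
      exact: H.
    move=> H; have {}H : \forall s \near t, `[0, 1]%classic (2 * s - 1) -> B (gamma2 (2 * s - 1)).
      exact: (cont21 (x := t) H).
    have : \forall s \near t, _ := H; apply: filterS => {}s {}H.
    by rewrite /= in_itv /= => s01; rewrite cE; [apply: H; rewrite /= in_itv /=|]; lra.
- by rewrite /concat ifT ?mulr0 //; lra.
- rewrite /concat ifF; last by apply/negbTE; rewrite -ltNge; lra.
  by rewrite -[RHS]g21; congr gamma2; lra.
- by move=> t t01; rewrite /concat; case: ifPn => t2; [apply: S1|apply: S2]; lra.
Qed.

Let continues_concat x0 gamma1 gamma2 f g h :
  loop_at x0 gamma1 -> loop_at x0 gamma2 ->
  continues_to gamma1 f g -> continues_to gamma2 g h ->
  continues_to (concat gamma1 gamma2) f h.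
Proof.
move=> [c1 g10 g11 S1] [c2 g20 g21 S2].
move=> [F1 [aF1 F10 F11 F1n]] [F2 [aF2 F20 F21 F2n]].
exists (fun t => if t <= 2^-1 then F1 (2 * t) else F2 (2 * t - 1)); split.
- by move=> t t01; rewrite /concat; case: ifPn => t2; [apply: aF1|apply: aF2]; lra.
- by rewrite /concat !ifT ?mulr0 //; lra.
- have n1 : (1 <= 2^-1 :> R) = false by apply/negbTE; rewrite -ltNge; lra.
  by rewrite /concat !n1; have -> : 2 * 1 - 1 = 1 :> R by lra.
move=> t t01; have [t2|t2|t2] := ltgtP t 2^-1.
- have t01' : 0 <= 2 * t <= 1 by lra.
  have t_lt : \forall s \near t, s < 2^-1 by exact: lt_nbhsl.
  have := cont2 (F1n _ t01'); apply: filterS2 t_lt => s s2 /= H s01.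
  by rewrite /concat (ltW s2); apply: H; lra.
- have t01' : 0 <= 2 * t - 1 <= 1 by lra.
  have t_gt : \forall s \near t, 2^-1 < s by exact: lt_nbhsr.
  have := cont21 (F2n _ t01'); apply: filterS2 t_gt => s s2 /= H s01.
  by rewrite /concat leNgt s2 /=; apply: H; lra.
- have i0 : 0 <= (0 : R) <= 1 by rewrite lexx ler01.
  have i1 : 0 <= (1 : R) <= 1 by rewrite lexx ler01.
  have e1 : 2 * t = 1 by lra.
  have e0 : 2 * t - 1 = 0 by lra.
  have H1 : \forall u \near 2 * t, 0 <= u <= 1 ->
      germ_eq (gamma1 u) (F1 u) (F1 1) by rewrite e1; exact: F1n.
  have H2 : \forall u \near 2 * t - 1, 0 <= u <= 1 ->
      germ_eq (gamma2 u) (F2 u) (F2 0) by rewrite e0; exact: F2n.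
  have H3 : \forall u \near 2 * t - 1, 0 <= u <= 1 ->
      germ_eq (gamma2 u) (F2 0) (F1 1).
    have : germ_eq (gamma2 0) (F2 0) (F1 1).
      by apply: germ_eq_trans F20 _; rewrite g20 -g11; exact: germ_eq_sym.
    move/near_join => G.
    have := c2; rewrite subspace_continuousP => /(_ 0).
    rewrite /= in_itv => /(_ i0) /(_ _ G) {}G; rewrite e0.
    have : \forall u \near (0 : R), `[0, 1]%classic u ->
      germ_eq (gamma2 u) (F2 0) (F1 1) by exact: G.
    by apply: filterS => u Hu u01; apply: Hu; rewrite /= in_itv.
  have G1 : \forall s \near t, 0 <= 2 * s <= 1 ->
    germ_eq (gamma1 (2 * s)) (F1 (2 * s)) (F1 1) := cont2 (x := t) H1.
  have G2 : \forall s \near t, 0 <= 2 * s - 1 <= 1 ->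
    germ_eq (gamma2 (2 * s - 1)) (F2 (2 * s - 1)) (F2 0) := cont21 (x := t) H2.
  have G3 : \forall s \near t, 0 <= 2 * s - 1 <= 1 ->
    germ_eq (gamma2 (2 * s - 1)) (F2 0) (F1 1) := cont21 (x := t) H3.
  apply: filterS3 G1 G2 G3 => s G1 G2 G3 s01.
  rewrite e1 /concat; case: ifPn => s2; first by apply: G1; lra.
  by apply: germ_eq_trans (G2 _) (G3 _); lra.
Qed.

Lemma monodromy_group_set x0 Y : ~ Sigma x0 -> all_germs x0 Y ->
  group_set (monodromy x0 Y).
Proof.
move=> Sx0 [Yy _ _]; apply/group_setP; split.
  rewrite inE; apply/asboolP; exists (fun=> x0); split.
    by split=> //; apply: continuous_subspaceT => t; exact: cvg_cst.
  move=> i; rewrite perm1; exists (fun=> Y i); split.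
  - by move=> t _; have [] := Yy i.
  - exact: germ_eq_refl.
  - exact: germ_eq_refl.
  - by move=> t _; apply: (@filterE _ (nbhs t)) => s _; exact: germ_eq_refl.
move=> s t; rewrite !inE => - [g1 [l1 c1]] [g2 [l2 c2]].
exists (concat g1 g2); split; first exact: loop_concat.
by move=> i; rewrite permM; exact: continues_concat l1 l2 (c1 i) (c2 (s i)).
Qed.

End AlgebraicFunction.

Arguments all_germs {R N} P x0 Y.
Arguments loop_at {R N} P x0 gamma.
Arguments monodromy {R N} P x0 Y.

(* Main.v *)
Require Import Defs.
From HB Require Import structures.
From mathcomp Require Import all_boot all_order all_algebra all_fingroup all_solvable.
From mathcomp Require Import all_classical all_reals all_analysis.
From mathcomp Require Import fraction mxpoly polydiv complex zify lra ring qpoly.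
From mathcomp Require Import -(notations) mpoly.

Set Implicit Arguments.
Unset Strict Implicit.
Unset Printing Implicit Defensive.

Import Order.TTheory GRing.Theory Num.Theory.
Import numFieldNormedType.Exports.

Local Open Scope classical_set_scope.
Local Open Scope ring_scope.

(** Let [n] be the degree of [P] and [G] its monodromy group, acting on the ring
    [A = C[T_1, ..., T_n]] by permutation of the variables. Evaluation of the variables
    at the germs [Y_1, ..., Y_n] maps [A] to the germs at [x0], and respects sums and
    powers; it is thus enough to build [T_1] by sums and root extractions from elements
    of [A] whose evaluations are rational. The elements invariant under [G] will do, for
    an algebraic and an analytic reason.

    The algebraic one is [solvable_descent]: when a finite solvable group acts on a
    commutative algebra over [C], all elements are built from the invariant ones by sums
    and root extractions. If [H] is a normal subgroup of prime index [p], an element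
    invariant under [H] is the sum of its [p] Lagrange resolvents, and the [p]-th powers
    of these are invariant under the whole group.

    The analytic one is [invariant_rational_germ]. The labelled roots of the equation are
    continued from [x0] along chains of balls free of singular points, on which the roots
    are continuous functions. Two labellings reached at the same point differ by an
    element of [G], for a chain that returns to [x0] yields a loop, along which the germs
    continue ([linked_monodromy]). An invariant [Phi] thus takes a single value at each
    point reached. As the points reached are open and closed among the regular ones, [Phi]
    extended by 0 to the other points keeps its local properties at all the regular
    points. A complex line through a regular point has finitely many singular points, and
    the roots multiplied by the leading coefficient grow polynomially; by a form of
    Liouville's theorem ([polynomial_of_growth]), a suitable power of the leading
    coefficient times [Phi] is a polynomial on the line, of a degree bounded independently
    of the line. A function that is polynomial in each coordinate with bounded degree is a
    polynomial, by interpolation ([separately_polynomial]); so [Phi] is a quotient of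
    polynomials near [x0].

    Liouville's theorem is derived from the maximum principle, and the latter from second
    order expansions, by averaging over four points ([four_point_average]). For the roots
    these expansions are algebraic: at a point [x'] near [x], the factorization of [P] at
    the root [h_i(x)] reads
      [h_i(x') = h_i(x) - P_x'(h_i(x)) / (c(x') prod_(j <> i) (h_i(x) - h_j(x')))]
    where [c] is the leading coefficient and the numerator, a polynomial in [x'], vanishes
    at [x]; continuity of the roots gives a first order expansion, and each expansion gives
    the next one ([root_increment], [taylor_chart]). *)

(* Simplification would otherwise unfold [Cplx R] to [R[i]], a type on which no
   topology is inferred. *)
Arguments Cplx : simpl never.

(** * Solvable group actions and root extraction *)

Inductive radical_closure (A : pzRingType) (B : A -> Prop) : A -> Prop :=
| radical_base a of B a : radical_closure B a
| radical_add a b of radical_closure B a & radical_closure B b :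
    radical_closure B (a + b)
| radical_root q a of (0 < q)%N & radical_closure B (a ^+ q) :
    radical_closure B a.

Lemma radical_closure_trans (A : pzRingType) (B B' : A -> Prop) a :
  (forall b, B b -> radical_closure B' b) ->
  radical_closure B a -> radical_closure B' a.
Proof.
move=> BB'; elim=> [b /BB' //|b c _ Bb _ Bc|q b q_gt0 _ Bb].
- exact: radical_add.
- exact: radical_root Bb.
Qed.

Lemma radical_sum (A : pzRingType) (B : A -> Prop) n (r : nat -> A) :
  (forall k, radical_closure B (r k)) -> radical_closure B (\sum_(k < n.+1) r k).
Proof.
move=> rad_r; elim: n => [|n IHn]; first by rewrite big_ord1.
by rewrite big_ord_recr; apply: radical_add.
Qed.

(** The roots of [1 + X + ... + X^(p-1)] are the nontrivial [p]-th roots of unity;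
    the vanishing sums are the orthogonality relations that invert a discrete
    Fourier transform of length [p]. *)
Lemma prime_root_of_unity (F : numClosedFieldType) p : prime p ->
  exists z : F, z ^+ p = 1 /\
    forall j, ~~ (p %| j)%N -> \sum_(k < p) z ^+ (j * k) = 0.
Proof.
move=> p_prime; have p_gt1 := prime_gt1 p_prime.
pose Q : {poly F} := \poly_(i < p) 1.
have sQ : size Q = p.
  by rewrite size_poly_eq ?oner_eq0.
have [z Qz] : exists z, root Q z.
  by apply/closed_rootP; rewrite sQ neq_ltn p_gt1 orbT.
have zp : z ^+ p = 1.
  apply/eqP; rewrite -subr_eq0 subrX1.
  move: Qz; rewrite rootE horner_poly (eq_bigr (fun i : 'I_p => z ^+ i)) => [|i _].
    by move=> /eqP ->; rewrite mulr0.
  by rewrite mul1r.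
have z1 : z != 1.
  apply/negP => /eqP z1; move: Qz; rewrite z1 rootE horner_poly.
  rewrite (eq_bigr (fun=> 1)) => [|i _]; last by rewrite expr1n mul1r.
  by rewrite sumr_const card_ord pnatr_eq0 eqn0Ngt prime_gt0.
exists z; split=> // j pj.
have zj : z ^+ j != 1.
  apply: contraNneq z1 => zj.
  have /eqnP pj1 : coprime p j by rewrite prime_coprime.
  have [u v uvE _] := egcdnP j (prime_gt0 p_prime).
  move: uvE; rewrite pj1 => uvE.
  have : z ^+ (u * p) = z ^+ (v * j + 1) by rewrite uvE.
  by rewrite exprD !(mulnC _ p, mulnC _ j) !exprM zp zj !expr1n mul1r expr1 => /eqP;
    rewrite eq_sym.
have /eqP := subrX1 (z ^+ j) p.
rewrite -exprM mulnC exprM zp expr1n subrr eq_sym mulf_eq0 subr_eq0 (negbTE zj) /=.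
by move=> /eqP E; rewrite -[RHS]E; apply: eq_bigr => k _; rewrite exprM.
Qed.

Section SolvableDescent.
Variables (F : numClosedFieldType) (A : comAlgType F) (gT : finGroupType).
Variable act : gT -> {lrmorphism A -> A}.
Hypothesis act1 : forall a, act 1%g a = a.
Hypothesis actM : forall x y a, act (x * y)%g a = act y (act x a).

Let actZ x c a : act x (c *: a) = c *: act x a.
Proof. exact: linearZZ. Qed.

Definition invariant_under (G : {set gT}) (a : A) : Prop :=
  forall x, x \in G -> act x a = a.

Lemma stabilizer_group_set (G : {group gT}) a :
  group_set [set x in G | act x a == a]%SET.
Proof.
apply/group_setP; split; first by rewrite inE group1 act1 eqxx.
move=> x y; rewrite !inE => /andP[Gx /eqP xa] /andP[Gy /eqP ya].
by rewrite groupM // actM xa ya eqxx.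
Qed.

(** Modulo [H], a single [g] generates [G]. For a [p]-th root of unity [z] other than
    [1], the resolvents [r k = sum_j z^(jk) g^j b] are eigenvectors of [g] whose
    eigenvalues are [p]-th roots of unity, so that their [p]-th powers are invariant
    under [G]; by Fourier inversion their sum is [p b], which is [a]. *)
Lemma lagrange_resolvent (G H : {group gT}) a :
  normal H G -> prime #|G : H|%g -> invariant_under H a ->
  radical_closure (invariant_under G) a.
Proof.
move=> nHG p_prime Ha; set p := #|G : H|%g in p_prime.
have /andP[sHG nGH] := nHG.
have maxH : maximal H G by apply: p_index_maximal.
have [g Gg Hg] : exists2 g, g \in G & g \notin H.
  have /andP[_ /subsetPn[g]] := maxgroupp maxH; by exists g.
have gp : (g ^+ p)%g \in H.
  have Ng := fintype.subsetP nGH _ Gg.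
  apply: coset_idr; first exact: groupX.
  rewrite morphX //= /p -card_quotient //; apply: expg_cardG.
  exact: mem_quotient.
have [z [zp zsum]] := prime_root_of_unity F p_prime.
have p_gt0 := prime_gt0 p_prime.
have pF : (p%:R : F) != 0 by rewrite pnatr_eq0 -lt0n.
pose b := p%:R^-1 *: a.
have Hb : invariant_under H b by move=> x Hx; rewrite actZ Ha.
pose r (k : nat) := \sum_(j < p) z ^+ (j * k) *: act (g ^+ j)%g b.
have -> : a = \sum_(k < p) r k.
  rewrite exchange_big /= (bigD1 (Ordinal p_gt0)) //=.
  rewrite [X in _ + X]big1 ?addr0 => [|j].
    rewrite (eq_bigr (fun=> b)) => [|k _].
      by rewrite sumr_const card_ord -scaler_nat scalerA mulfV // scale1r.
    by rewrite mul0n expr0 scale1r expg0 act1.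
  rewrite -val_eqE /= -lt0n => j_gt0; rewrite -scaler_suml zsum ?scale0r //.
  by rewrite gtnNdvd.
have gr k : act g (z ^+ k *: r k) = r k.
  pose f j := z ^+ (j * k) *: act (g ^+ j)%g b.
  rewrite actZ /r raddf_sum scaler_sumr /=.
  have fS j : z ^+ k *: act g (f j) = f j.+1.
    by rewrite /f actZ -actM -expgSr scalerA -exprD -mulSn.
  have fp : f p = f 0%N.
    by rewrite /f exprM zp expr1n mul0n expg0 act1 Hb.
  rewrite (eq_bigr (fun j : 'I_p => f j.+1)) => [|j _]; last exact: fS.
  (* Shifting the index is harmless: the terms are periodic with period [p]. *)
  apply: (addrI (f 0%N)); rewrite -(big_ord_recl p (fun j => f j)).
  by rewrite big_ord_recr fp addrC.
have rH k x : x \in H -> act x (r k) = r k.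
  move=> Hx; rewrite raddf_sum /=; apply: eq_bigr => j _.
  rewrite actZ -actM; congr (_ *: _).
  have Ngj : (g ^+ j)%g \in 'N(H)%g by rewrite groupX // (fintype.subsetP nGH).
  have -> : (g ^+ j * x = x ^ (g ^+ j)^-1 * g ^+ j)%g.
    by rewrite conjgE invgK -!mulgA mulVg mulg1.
  by rewrite actM Hb // memJ_norm // groupV.
have rad_r k : radical_closure (invariant_under G) (r k).
  apply: (@radical_root _ _ p) => //; apply: radical_base.
  pose S := Group (stabilizer_group_set G (r k ^+ p)).
  have sHS : H \subset S.
    apply/fintype.subsetP => x Hx; rewrite inE (fintype.subsetP sHG) //=.
    by rewrite rmorphXn /= rH.
  have sSG : S \subset G by apply/fintype.subsetP => x; rewrite inE => /andP[].
  have gS : g \in S.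
    rewrite inE Gg /=; apply/eqP.
    rewrite -{2}(gr k) actZ exprZn exprAC zp expr1n scale1r.
    by rewrite rmorphXn.
  have SG : S :=: G.
    case: (eqVproper sSG) => // SpG; move: Hg.
    have /maxgroupP[_ /(_ _ SpG sHS) <-] := maxH.
    by rewrite gS.
  by move=> x; rewrite -SG inE => /andP[_ /eqP].
by rewrite -(prednK p_gt0); exact: radical_sum.
Qed.

(** A normal subgroup [H] of prime index reduces the claim for [G] to that for [H]:
    what is built from [H]-invariants is built from [G]-invariants, each
    [H]-invariant being so. *)
Lemma solvable_descent (G : {group gT}) a :
  solvable G -> radical_closure (invariant_under G) a.
Proof.
move: {2}#|G|.+1 (ltnSn #|G|) => n; elim: n G a => // n IHn G a.
rewrite ltnS => leGn solG; have [G1|G1] := eqVneq (G : {set gT}) 1%g.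
  by apply: radical_base => x; rewrite G1 => /set1P ->; exact: act1.
have [H nHG p_prime] := sol_prime_factor_exists solG G1.
have [sHG nGH] := andP nHG.
have HltG : (#|H| < #|G|)%N.
  rewrite -(Lagrange sHG) -[ltnLHS]muln1 ltn_pmul2l ?cardG_gt0 //.
  exact: prime_gt1.
apply: radical_closure_trans (IHn H a _ _); last exact: solvableS solG.
  by move=> b; exact: lagrange_resolvent.
exact: leq_trans leGn.
Qed.
End SolvableDescent.

(** * The real-valued modulus *)

(** The norm of a complex number is a complex number; [cabs] is the same modulus as a
    real number, so that moduli can always be compared. *)
Section ComplexModulus.
Variable R : realType.
Local Notation C := (Cplx R).
Implicit Types (z w : C) (x y : R).

Definition toC x : C := real_complex R x.

Definition cabs z : R := complex.Re `|z|.

Lemma normC_cabs z : `|z| = toC (cabs z).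
Proof. by rewrite /cabs normc_def. Qed.

Lemma cabsE z : cabs z = Num.sqrt (complex.Re z ^+ 2 + complex.Im z ^+ 2).
Proof. by rewrite /cabs normc_def. Qed.

Lemma sqr_cabs z : cabs z ^+ 2 = complex.Re z ^+ 2 + complex.Im z ^+ 2.
Proof. by rewrite cabsE sqr_sqrtr // addr_ge0 ?sqr_ge0. Qed.

Lemma cabs_ge0 z : 0 <= cabs z.
Proof. by rewrite cabsE sqrtr_ge0. Qed.

Lemma toC0 : toC 0 = 0. Proof. exact: rmorph0. Qed.
Lemma toC1 : toC 1 = 1. Proof. exact: rmorph1. Qed.
Lemma toCD x y : toC (x + y) = toC x + toC y. Proof. exact: rmorphD. Qed.
Lemma toCM x y : toC (x * y) = toC x * toC y. Proof. exact: rmorphM. Qed.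

Lemma toC_inj : injective toC. Proof. exact: complexI. Qed.

Lemma cabsM z w : cabs (z * w) = cabs z * cabs w.
Proof. by apply: toC_inj; rewrite -normC_cabs normrM !normC_cabs toCM. Qed.

Lemma cabs1 : cabs 1 = 1.
Proof. by apply: toC_inj; rewrite -normC_cabs normr1 toC1. Qed.

Lemma cabs0 : cabs 0 = 0.
Proof. by apply: toC_inj; rewrite -normC_cabs normr0 toC0. Qed.

Lemma cabsX z n : cabs (z ^+ n) = cabs z ^+ n.
Proof.
by elim: n => [|n IHn]; [rewrite !expr0 cabs1|rewrite !exprS cabsM IHn].
Qed.

Lemma cabsN z : cabs (- z) = cabs z.
Proof. by rewrite /cabs normrN. Qed.

Lemma cabs_eq0 z : (cabs z == 0) = (z == 0).
Proof.
apply/eqP/eqP => [z0|->]; last exact: cabs0.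
by apply/eqP; rewrite -normr_eq0 normC_cabs z0 toC0.
Qed.

Lemma cabs_gt0 z : (0 < cabs z) = (z != 0).
Proof. by rewrite lt_def cabs_ge0 andbT cabs_eq0. Qed.

Lemma cabsV z : cabs z^-1 = (cabs z)^-1.
Proof.
have [->|z0] := eqVneq z 0; first by rewrite invr0 cabs0 invr0.
apply: (@mulfI _ (cabs z)); first by rewrite cabs_eq0.
by rewrite -cabsM !mulfV ?cabs1 // cabs_eq0.
Qed.

Lemma lec_toC x y : (toC x <= toC y) = (x <= y). Proof. exact: lecR. Qed.
Lemma ltc_toC x y : (toC x < toC y) = (x < y). Proof. exact: ltcR. Qed.

Lemma cabsD z w : cabs (z + w) <= cabs z + cabs w.
Proof.
by rewrite -lec_toC toCD -!normC_cabs ler_normD.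
Qed.

Lemma cabsB z w : cabs (z - w) <= cabs z + cabs w.
Proof. by rewrite -(cabsN w) cabsD. Qed.

Lemma cabs_sum I (r : seq I) (F : I -> C) :
  cabs (\sum_(i <- r) F i) <= \sum_(i <- r) cabs (F i).
Proof.
elim/big_rec2: _ => [|i y z _ IH]; first by rewrite cabs0.
by apply: le_trans (cabsD _ _) _; rewrite lerD2l.
Qed.

Lemma cabs_prod I (r : seq I) (F : I -> C) :
  cabs (\prod_(i <- r) F i) = \prod_(i <- r) cabs (F i).
Proof. by apply: (big_morph cabs cabsM cabs1). Qed.

Lemma cabs_toC x : cabs (toC x) = `|x|.
Proof. by rewrite cabsE /= expr0n /= addr0 sqrtr_sqr. Qed.

Lemma cabs_i : cabs (complex.Complex 0 1) = 1.
Proof. by rewrite cabsE /= expr0n /= add0r expr1n sqrtr1. Qed.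

Lemma ReD z w : complex.Re (z + w) = complex.Re z + complex.Re w.
Proof. by case: z; case: w. Qed.
Lemma ImD z w : complex.Im (z + w) = complex.Im z + complex.Im w.
Proof. by case: z; case: w. Qed.
Lemma ReN z : complex.Re (- z) = - complex.Re z. Proof. by case: z. Qed.
Lemma ImN z : complex.Im (- z) = - complex.Im z. Proof. by case: z. Qed.

Lemma normRe_le_cabs z : `|complex.Re z| <= cabs z.
Proof.
by rewrite -(ler_sqr (normr_nneg _)) ?nnegrE ?cabs_ge0 // sqr_cabs real_normK ?num_real // lerDl sqr_ge0.
Qed.

Lemma normIm_le_cabs z : `|complex.Im z| <= cabs z.
Proof.
by rewrite -(ler_sqr (normr_nneg _)) ?nnegrE ?cabs_ge0 // sqr_cabs real_normK ?num_real // lerDr sqr_ge0.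
Qed.

Lemma gt0_toC (e : C) : 0 < e -> exists2 r : R, 0 < r & e = toC r.
Proof.
move=> e_gt0; exists (cabs e); first by rewrite cabs_gt0 gt_eqF.
by rewrite -normC_cabs gtr0_norm.
Qed.

Lemma near_cabsP z (P : set C) : (\forall w \near z, P w) <->
  exists2 r : R, 0 < r & forall w, cabs (w - z) < r -> P w.
Proof.
rewrite -nbhs_nearE nbhs_ballP; split=> [[e /gt0_toC[r r_gt0 ->] zP]|[r r_gt0 zP]].
  exists r => // w wz; apply: zP.
  by rewrite -ball_normE /ball_ /= distrC normC_cabs ltc_toC.
exists (toC r) => [|w]; first by rewrite /= -toC0 ltc_toC.
by rewrite -ball_normE /ball_ /= distrC normC_cabs ltc_toC; exact: zP.
Qed.

Lemma continuous_cabsP (f : C -> C) z : f @ z --> f z <->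
  forall e : R, 0 < e -> \forall w \near z, cabs (f w - f z) < e.
Proof.
have FF : Filter (nbhs (z : C)) := nbhs_filter _.
split=> [/cvgrPdist_lt fz e e_gt0|fz].
  have := fz (toC e); rewrite -toC0 ltc_toC => /(_ e_gt0).
  by apply: filterS => w; rewrite distrC normC_cabs ltc_toC.
apply/cvgrPdist_lt => _ /gt0_toC[e e_gt0 ->].
by apply: filterS (fz _ e_gt0) => w; rewrite distrC normC_cabs ltc_toC.
Qed.
End ComplexModulus.

(** * Expansions of finite order at 0 *)

Section Taylor.
Variable R : realType.
Local Notation C := (Cplx R).
Implicit Types (f g : C -> C) (z : C).

Let FF : Filter (nbhs (0 : C)) := nbhs_filter _.

Definition continuous0 f := f @ (0 : C) --> f 0.

Lemma continuous0_eq f g :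
  (\forall w \near (0 : C), f w = g w) -> continuous0 f -> continuous0 g.
Proof.
move=> fg; rewrite /continuous0 -(nbhs_singleton fg); apply: cvg_trans.
exact: near_eq_cvg.
Qed.

Lemma continuous0_cst c : continuous0 (fun=> c).
Proof. exact: cvg_cst. Qed.

Lemma continuous0_id : continuous0 (fun w => w).
Proof. exact: cvg_id. Qed.

Lemma continuous0D f g :
  continuous0 f -> continuous0 g -> continuous0 (fun w => f w + g w).
Proof. by move=> f0 g0; apply: cvgD f0 g0. Qed.

Lemma continuous0M f g :
  continuous0 f -> continuous0 g -> continuous0 (fun w => f w * g w).
Proof. by move=> f0 g0; apply: cvgM f0 g0. Qed.

Lemma continuous0V f : f 0 != 0 -> continuous0 f -> continuous0 (fun w => (f w)^-1).
Proof. by move=> fN0 f0; apply: cvgV fN0 f0. Qed.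

(** Finite order differentiability in the style of Caratheodory: iterating
    [f w = f 0 + w * g w] gives an expansion of order [k] whose last coefficient is a
    continuous function of [w]. In this form, closure under products and inverses is
    an identity between factors. *)
Fixpoint taylor k f : Prop :=
  if k is k'.+1 then
    exists2 g, taylor k' g & \forall w \near (0 : C), f w = f 0 + w * g w
  else continuous0 f.

Lemma taylor_eq k f g :
  (\forall w \near (0 : C), f w = g w) -> taylor k f -> taylor k g.
Proof.
move=> fg; have fg0 := nbhs_singleton fg.
case: k => [|k]; first exact: continuous0_eq.
by case=> h kh fE; exists h => //; apply: filterS2 fg fE => w <- ->; rewrite fg0.
Qed.

Lemma taylor_cst k c : taylor k (fun=> c).
Proof.
elim: k c => [|k IHk] c; first exact: continuous0_cst.
by exists (fun=> 0); [exact: IHk|apply: filterE => w; rewrite mulr0 addr0].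
Qed.

Lemma taylor_id k : taylor k (fun w => w).
Proof.
case: k => [|k]; first exact: continuous0_id.
by exists (fun=> 1); [exact: taylor_cst|apply: filterE => w; rewrite mulr1 add0r].
Qed.

Lemma taylor_continuous k f : taylor k f -> continuous0 f.
Proof.
elim: k f => [//|k IHk] f [g /IHk g0 fE]; apply: (@taylor_eq 0 (fun w => f 0 + w * g w)).
  by apply: filterS fE => w ->.
by apply: continuous0D; [exact: continuous0_cst|apply: continuous0M;
  [exact: continuous0_id|]].
Qed.

Lemma taylorD k f g : taylor k f -> taylor k g -> taylor k (fun w => f w + g w).
Proof.
elim: k f g => [|k IHk] f g; first exact: continuous0D.
move=> [f1 kf1 fE] [g1 kg1 gE]; exists (fun w => f1 w + g1 w); first exact: IHk.
by apply: filterS2 fE gE => w -> ->; rewrite mulrDr addrACA.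
Qed.

Lemma taylorS k f : taylor k.+1 f -> taylor k f.
Proof.
elim: k f => [|k IHk] f; first exact: taylor_continuous.
by case=> g kg fE; exists g => //; exact: IHk.
Qed.

Lemma taylorM k f g : taylor k f -> taylor k g -> taylor k (fun w => f w * g w).
Proof.
elim: k f g => [|k IHk] f g; first exact: continuous0M.
move=> kf kg; have [f1 kf1 fE] := kf; have [g1 kg1 gE] := kg.
exists (fun w => f1 w * g w + f 0 * g1 w).
  by apply: taylorD; apply: IHk => //; [exact: taylorS|exact: taylor_cst].
apply: filterS2 fE gE => w fw gw.
by rewrite [in LHS]fw mulrDl {1}gw; ring.
Qed.

Lemma taylorV k f : f 0 != 0 -> taylor k f -> taylor k (fun w => (f w)^-1).
Proof.
move=> f0; elim: k => [|k IHk] kf; first exact: continuous0V.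
have [g kg fE] := kf; exists (fun w => - g w * (f w)^-1 * (f 0)^-1).
  apply: taylorM (taylor_cst _ _); apply: taylorM (IHk (taylorS kf)).
  apply: (@taylor_eq k (fun w => -1 * g w)).
    by apply: filterE => w; rewrite mulN1r.
  by apply: taylorM => //; exact: taylor_cst.
have f_neq0 : \forall w \near (0 : C), f w != 0.
  have /continuous_cabsP/(_ (cabs (f 0))) := taylor_continuous kf.
  rewrite cabs_gt0 => /(_ f0); apply: filterS => w; apply: contraTneq => ->.
  by rewrite sub0r cabsN ltxx.
apply: filterS2 fE f_neq0 => w fE fw.
apply: (mulfI fw); rewrite mulfV // mulrDr; apply: (mulfI f0).
rewrite mulr1 mulrDr [f w / _]mulrC mulVKf //.
have -> : f 0 * (f w * (w * (- g w / f w / f 0))) = - (w * g w).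
  by field; rewrite f0 fw.
by rewrite fE addrK.
Qed.

Lemma taylor_prod k I (r : seq I) (Q : pred I) (F : I -> C -> C) :
  (forall i, taylor k (F i)) -> taylor k (fun w => \prod_(i <- r | Q i) F i w).
Proof.
move=> kF; elim: r => [|i r IHr].
  apply: taylor_eq (taylor_cst k 1); apply: filterE => w; by rewrite big_nil.
have [Qi|Qi] := boolP (Q i).
  apply: taylor_eq (taylorM (kF i) IHr).
  by apply: filterE => w; rewrite big_cons Qi.
by apply: taylor_eq IHr; apply: filterE => w; rewrite big_cons (negbTE Qi).
Qed.

Lemma taylor_horner k (p : {poly C}) f :
  taylor k f -> taylor k (fun w => p.[f w]).
Proof.
move=> kf; elim/poly_ind: p => [|p c IHp].
  by apply: taylor_eq (taylor_cst k 0); apply: filterE => w; rewrite horner0.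
apply: taylor_eq (taylorD (taylorM IHp kf) (taylor_cst k c)).
by apply: filterE => w; rewrite hornerMXaddC.
Qed.
Lemma taylor_shift k z : taylor k (fun w : C => z + w).
Proof. by apply: taylorD; [exact: taylor_cst|exact: taylor_id]. Qed.

Lemma taylorX k f n : taylor k f -> taylor k (fun w => f w ^+ n).
Proof.
by move=> kf; apply: taylor_eq (taylor_horner 'X^n kf); apply: filterE => w;
  rewrite hornerXn.
Qed.
End Taylor.

(** * The maximum principle from second order expansions *)

Section MaximumPrinciple.
Variable R : realType.
Local Notation C := (Cplx R).
Implicit Types (h : C -> C) (z w : C).

Let I : C := complex.Complex 0 1.

(** The mean value property up to order 2: over the four points [t], [it], [-t], [-it]
    both the sum of the points and the sum of their squares vanish, so that only the
    remainder of the expansion survives. *)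
Lemma four_point_average (f : C -> C) : taylor 2 f ->
  forall e : R, 0 < e -> exists2 d : R, 0 < d & forall t : R, 0 < t < d ->
    cabs (f (toC t) + f (I * toC t) + f (- toC t) + f (- (I * toC t)) - f 0 *+ 4)
      <= e * t ^+ 2.
Proof.
move=> [g [k k0 gE] fE] e e_gt0.
have e4 : 0 < e / 4 by rewrite divr_gt0.
have /continuous_cabsP/(_ _ e4)/near_cabsP[d1 d1_gt0 kd] := k0.
have /near_cabsP[d2 d2_gt0 gd] := gE.
have /near_cabsP[d3 d3_gt0 fd] := fE.
exists (Num.min d1 (Num.min d2 d3)) => [|t]; first by rewrite !lt_min d1_gt0 d2_gt0.
rewrite !lt_min => /and4P[t_gt0 td1 td2 td3].
have II : I * I = -1 by apply/eqP;
  rewrite eq_complex /= !(mul0r, mulr0, mulr1, add0r, addr0, sub0r, oppr0) !eqxx.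
have fw w : cabs w = t -> f w = f 0 + w * (g 0 + w * k w).
  by move=> wt; rewrite (fd w) ?(gd w) // subr0 wt.
have kw w : cabs w = t -> cabs (k w - k 0) <= e / 4.
  by move=> wt; apply/ltW/kd; rewrite subr0 wt.
have w1 : cabs (toC t) = t by rewrite cabs_toC gtr0_norm.
have w2 : cabs (I * toC t) = t by rewrite cabsM cabs_i mul1r.
have w3 : cabs (- toC t) = t by rewrite cabsN.
have w4 : cabs (- (I * toC t)) = t by rewrite cabsN.
have -> : f (toC t) + f (I * toC t) + f (- toC t) + f (- (I * toC t)) - f 0 *+ 4 =
    toC t ^+ 2 * ((k (toC t) - k 0) - (k (I * toC t) - k 0)
                 + (k (- toC t) - k 0) - (k (- (I * toC t)) - k 0)).
  rewrite (fw _ w1) (fw _ w2) (fw _ w3) (fw _ w4).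
  set T := toC t; set a1 := k T; set a2 := k (I * T); set a3 := k (- T); set a4 :=
    k (- (I * T)).
  have IT x : I * (I * x) = - x by rewrite mulrA II mulN1r.
  have -> : I * T * (g 0 + I * T * a2) = I * T * g 0 - T * T * a2.
    by rewrite mulrDr; congr (_ + _); rewrite -!mulrA [T * (I * _)]mulrCA IT.
  have -> : - (I * T) * (g 0 + - (I * T) * a4) = - (I * T * g 0) - T * T * a4.
    by rewrite mulrDr !mulNr mulrN opprK; congr (_ + _);
      rewrite -!mulrA [T * (I * _)]mulrCA IT.
  by ring.
rewrite cabsM cabsX w1 mulrC ler_pM2r ?exprn_gt0 //.
have := kw _ w1; have := kw _ w2; have := kw _ w3; have := kw _ w4.
set A1 := k _ - _; set A2 := k _ - _; set A3 := k _ - _; set A4 := k _ - _.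
move=> H1 H2 H3 H4.
apply: le_trans (cabsB _ _) _; apply: le_trans (lerD (cabsD _ _) (lexx _)) _.
apply: le_trans (lerD (lerD (cabsB _ _) (lexx _)) (lexx _)) _.
by lra.
Qed.

(** The term [e |z|^2] has average excess [e t^2] over the four points, while
    [2 Re (conj (h z) * h w) <= |h z|^2 + |h w|^2] reduces the squared modulus to an
    expression linear in [h w], whose average excess is [o(t^2)]. *)
Lemma perturbed_modulus_no_local_max h z (e d : R) :
  taylor 2 (fun w => h (z + w)) -> 0 < e -> 0 < d ->
  exists2 w, cabs w < d &
    cabs (h z) ^+ 2 + e * cabs z ^+ 2 < cabs (h (z + w)) ^+ 2 + e * cabs (z + w) ^+ 2.
Proof.
move=> h2 e_gt0 d_gt0; apply: contrapT => no_w.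
have max w : cabs w < d ->
    cabs (h (z + w)) ^+ 2 + e * cabs (z + w) ^+ 2 <= cabs (h z) ^+ 2 + e * cabs z ^+ 2.
  by move=> wd; rewrite leNgt; apply/negP => lt; apply: no_w; exists w.
have H_ge0 := cabs_ge0 (h z).
pose n := e / (1 + cabs (h z)).
have n_gt0 : 0 < n by rewrite divr_gt0 // ltr_pwDl.
have nE : n * cabs (h z) < e.
  have -> : e = n * (1 + cabs (h z)) by rewrite mulfVK // gt_eqF // ltr_pwDl.
  by rewrite ltr_pM2l // ltrDr.
have [d' d'_gt0 avg] := four_point_average h2 n_gt0.
pose t := Num.min d d' / 2.
have m_gt0 : 0 < Num.min d d' by rewrite lt_min d_gt0.
have t_gt0 : 0 < t by rewrite divr_gt0.
have : t < Num.min d d' by rewrite /t; lra.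
rewrite lt_min => /andP[td td'].
have {avg} := avg t; rewrite t_gt0 td' => /(_ isT).
have w1 : cabs (toC t) = t by rewrite cabs_toC gtr0_norm.
have := max (toC t); have := max (I * toC t); have := max (- toC t); have :=
  max (- (I * toC t)).
rewrite !cabsN cabsM cabs_i mul1r w1 td addr0 => /(_ isT) + /(_ isT) + /(_ isT) + /(_ isT).
have ReT : complex.Re (toC t) = t by [].
have ImT : complex.Im (toC t) = 0 by [].
have ReIT : complex.Re (I * toC t) = 0 by rewrite /= mul0r mulr0 subrr.
have ImIT : complex.Im (I * toC t) = t by rewrite /= mul0r mul1r add0r.
rewrite ![cabs (_ + _) ^+ 2 in X in X -> _]sqr_cabs.
rewrite !sqr_cabs !(ReD, ImD, ReN, ImN) ReT ImT ReIT ImIT.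
set q4 := h (z - I * _); set q3 := h (z - _); set q2 := h (z + I * _); set q1 := h (z + _).
set D := _ - h z *+ 4 => M4 M3 M2 M1 Dn.
have DRe : complex.Re D =
    complex.Re q1 + complex.Re q2 + complex.Re q3 + complex.Re q4 - 4 * complex.Re (h z).
  by rewrite /D !mulrS mulr0n !(ReD, ReN); ring.
have DIm : complex.Im D =
    complex.Im q1 + complex.Im q2 + complex.Im q3 + complex.Im q4 - 4 * complex.Im (h z).
  by rewrite /D !mulrS mulr0n !(ImD, ImN); ring.
have prod_bound (a b : R) : `|a| <= cabs (h z) -> `|b| <= n * t ^+ 2 ->
    - (cabs (h z) * (n * t ^+ 2)) <= a * b.
  move=> ah bn; rewrite lerNl (le_trans (ler_norm _)) // normrN normrM.
  by apply: ler_pM.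
have PRe := prod_bound _ _ (normRe_le_cabs (h z)) (le_trans (normRe_le_cabs D) Dn).
have PIm := prod_bound _ _ (normIm_le_cabs (h z)) (le_trans (normIm_le_cabs D) Dn).
have t2 : 0 < t ^+ 2 by rewrite exprn_gt0.
have : n * cabs (h z) * t ^+ 2 < e * t ^+ 2 by rewrite ltr_pM2r.
move: PRe PIm; rewrite DRe DIm; move: M1 M2 M3 M4.
have sq (u v : R) : 2 * (u * v) <= u ^+ 2 + v ^+ 2.
  by have := sqr_ge0 (u - v); rewrite sqrrB; lra.
have := sq (complex.Re (h z)) (complex.Re q1); have :=
  sq (complex.Re (h z)) (complex.Re q2).
have := sq (complex.Re (h z)) (complex.Re q3); have :=
  sq (complex.Re (h z)) (complex.Re q4).
have := sq (complex.Im (h z)) (complex.Im q1); have :=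
  sq (complex.Im (h z)) (complex.Im q2).
have := sq (complex.Im (h z)) (complex.Im q3); have :=
  sq (complex.Im (h z)) (complex.Im q4).
clear; lra.
Qed.

(** Squares are compact as products of segments, so the maximum is sought over the
    square circumscribed to a disc; this is why the bound on [h] is required up to
    radius [2 * r], beyond the corners of the square. *)
Let square_point (p : R * R) : C := complex.Complex p.1 p.2.

Lemma continuous_modulus_square h :
  (forall z, continuous0 (fun w => h (z + w))) ->
  continuous (fun p : R * R => cabs (h (square_point p))).
Proof.
move=> hc p; apply/cvgrPdist_lt => e e_gt0.
have /continuous_cabsP/(_ _ e_gt0)/near_cabsP[r r_gt0 hr] := hc (square_point p).
have r2 : 0 < r / 2 by rewrite divr_gt0.
have near_p : \forall q \near p, `|p.1 - q.1| < r / 2 /\ `|p.2 - q.2| < r / 2.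
  by exists (ball p.1 (r / 2), ball p.2 (r / 2)) => //; split; exact: nbhsx_ballx.
apply: filterS near_p => q [q1 q2].
have qr : cabs (square_point q - square_point p) < r.
  rewrite cabsE /=; apply: (@le_lt_trans _ _ (`|p.1 - q.1| + `|p.2 - q.2|)); last by lra.
  rewrite -[leRHS]ger0_norm ?addr_ge0 // -sqrtr_sqr ler_wsqrtr //.
  rewrite -(real_normK (num_real (q.1 - p.1))) -(real_normK (num_real (q.2 - p.2))).
  rewrite distrC [`|q.2 - _|]distrC sqrrD addrAC lerDl.
  by rewrite mulrn_wge0 // mulr_ge0.
have := hr (square_point q - square_point p); rewrite subr0 addr0 => /(_ qr).
rewrite [square_point p + _]addrC subrK; apply: le_lt_trans.
have := cabsD (h (square_point q) - h (square_point p)) (h (square_point p)).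
have := cabsB (h (square_point q)) (h (square_point q) - h (square_point p)).
rewrite subKr subrK => H1 H2; rewrite ler_norml; apply/andP; split; lra.
Qed.

(** Expansions are asked for only where [h] does not vanish: zeros cannot carry the
    maximum. This leaves room for functions that are merely continuous at some of
    their zeros. *)
Lemma maximum_principle h (r M : R) :
  (forall z, continuous0 (fun w => h (z + w))) ->
  (forall z, h z != 0 -> taylor 2 (fun w => h (z + w))) ->
  (forall z, r <= cabs z <= 2 * r -> cabs (h z) <= M) ->
  forall z, cabs z < r -> cabs (h z) <= M.
Proof.
move=> hc h2 hM z1 z1r; rewrite leNgt; apply/negP => z1M.
have r_gt0 : 0 < r by apply: le_lt_trans z1r; exact: cabs_ge0.
have M_ge0 : 0 <= M.
  by apply: le_trans (cabs_ge0 (h (toC r))) (hM _ _); rewrite cabs_toC gtr0_norm //; lra.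
(* On the square [|z|^2 <= 2 r^2], so the perturbation closes half of the gap at most. *)
pose e := (cabs (h z1) ^+ 2 - M ^+ 2) / (4 * r ^+ 2).
have r2_gt0 : 0 < r ^+ 2 by rewrite exprn_gt0.
have gap : 0 < cabs (h z1) ^+ 2 - M ^+ 2.
  by rewrite subr_gt0 ltr_pXn2r // nnegrE // cabs_ge0.
have e_gt0 : 0 < e by rewrite divr_gt0 // mulr_gt0.
have eE : e * r ^+ 2 *+ 4 = cabs (h z1) ^+ 2 - M ^+ 2.
  by rewrite /e -mulr_natl; field; rewrite gt_eqF.
pose A : set (R * R) := `[- r, r]%classic `*` `[- r, r]%classic.
pose u (p : R * R) := cabs (h (square_point p)) ^+ 2 + e * cabs (square_point p) ^+ 2.
have in_A (z : C) : cabs z < r -> (complex.Re z, complex.Im z) \in A.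
  move=> zr; rewrite inE; split => /=; rewrite in_itv /=.
    by rewrite -ler_norml (le_trans (normRe_le_cabs z)) // ltW.
  by rewrite -ler_norml (le_trans (normIm_le_cabs z)) // ltW.
have uE (z : C) : u (complex.Re z, complex.Im z) = cabs (h z) ^+ 2 + e * cabs z ^+ 2.
  by rewrite /u /square_point /=; case: z.
have cptA : compact A by apply: compact_setX; exact: segment_compact.
have A0 : A !=set0.
  by exists (complex.Re z1, complex.Im z1); have := in_A _ z1r; rewrite inE.
have uc : continuous u.
  move=> p; apply: cvgD.
    apply: (@cvg_comp _ _ _ (fun p => cabs (h (square_point p))) (fun x : R => x ^+ 2)).
      exact: continuous_modulus_square.
    exact: exprn_continuous.
  apply: cvgM; first exact: cvg_cst.
  apply: (@cvg_comp _ _ _ (fun p => cabs (square_point p)) (fun x : R => x ^+ 2)).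
    by apply: (@continuous_modulus_square id) => z; exact: (taylor_shift 0 z).
  exact: exprn_continuous.
have [p Ap pmax] := compact_EVT_max A0 cptA (continuous_subspaceT uc).
pose z := square_point p.
have zE : p = (complex.Re z, complex.Im z) by exact: surjective_pairing p.
have zmax w : cabs w < r -> cabs (h w) ^+ 2 + e * cabs w ^+ 2 <= cabs (h z) ^+ 2 + e * cabs z ^+ 2.
  by move=> wr; rewrite -!uE -zE; apply: pmax; exact: in_A.
have z1_le := zmax _ z1r.
have ez1 : 0 <= e * cabs z1 ^+ 2 by rewrite mulr_ge0 ?(ltW e_gt0) // exprn_ge0 // cabs_ge0.
have z2r : cabs z ^+ 2 <= r ^+ 2 *+ 2.
  rewrite sqr_cabs /=.
  move: Ap; rewrite inE => -[]; rewrite /= !in_itv /= -!ler_norml => p1 p2.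
  have := ler_pM (normr_ge0 _) (normr_ge0 _) p1 p1.
  have := ler_pM (normr_ge0 _) (normr_ge0 _) p2 p2.
  by rewrite -!expr2 !real_normK ?num_real //; lra.
have ez : e * cabs z ^+ 2 <= e * r ^+ 2 *+ 2.
  by rewrite -mulrnAr ler_pM2l.
have er : 0 < e * r ^+ 2 by rewrite mulr_gt0.
have [zr|zr] := ltP (cabs z) r; last first.
  have zr2 : cabs z <= 2 * r.
    rewrite -ler_sqr ?nnegrE ?cabs_ge0 ?mulr_ge0 ?(ltW r_gt0) // exprMn.
    by apply: le_trans z2r _; rewrite -mulr_natl; lra.
  have := hM z; rewrite zr zr2 => /(_ isT); rewrite -(ler_sqr) ?nnegrE ?cabs_ge0 // => hzM.
  move: eE ez er ez1 z1_le hzM.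
  move: (e * r ^+ 2) (M ^+ 2) (cabs (h z1) ^+ 2) (e * cabs z ^+ 2) (e * cabs z1 ^+ 2) (cabs (h z) ^+ 2).
  by clear=> *; lra.
have hz : h z != 0.
  apply/negP => /eqP hz; move: z1_le; rewrite hz cabs0 expr0n /= add0r.
  move: (sqr_ge0 M) eE ez er ez1.
  move: (e * r ^+ 2) (M ^+ 2) (cabs (h z1) ^+ 2) (e * cabs z ^+ 2) (e * cabs z1 ^+ 2).
  by clear=> *; lra.
have d_gt0 : 0 < r - cabs z by rewrite subr_gt0.
have [w wd] := perturbed_modulus_no_local_max (h2 z hz) e_gt0 d_gt0.
rewrite ltNge => /negP; apply; apply: zmax.
by apply: le_lt_trans (cabsD _ _) _; rewrite addrC -ltrBrDr.
Qed.
End MaximumPrinciple.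

(** * Functions of polynomial growth with finitely many singularities *)

Section Liouville.
Variable R : realType.
Local Notation C := (Cplx R).
Implicit Types (f : C -> C) (z w : C) (S : seq C).

(** Let [p] be the monic polynomial with roots [S]. Each [f ^+ n * p] extends
    continuously by 0 to [S], and the maximum principle applied to it gives
    [|f z1|^n |p z1| <= e^n B], where [e] bounds [f] far away and [B] bounds [p].
    As [|f z1| = 2 e], letting [n] grow is a contradiction. *)
Lemma decaying_eq0 f S (K : R) :
  (forall z, z \notin S -> taylor 2 (fun w => f (z + w))) ->
  (forall z, z \notin S -> cabs (f z) * (1 + cabs z) <= K) ->
  forall z, z \notin S -> f z = 0.
Proof.
move=> f2 fK z1 z1S; apply: contrapT => /eqP fz1.
have ge1 z : 1 <= 1 + cabs z by rewrite lerDl cabs_ge0.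
have K_ge0 : 0 <= K by apply: le_trans (fK _ z1S); rewrite mulr_ge0 ?addr_ge0 ?cabs_ge0.
pose e := cabs (f z1) / 2.
have e_gt0 : 0 < e by rewrite divr_gt0 // cabs_gt0.
pose r := K / e + cabs z1 + 1.
have Ke : 0 <= K / e by rewrite divr_ge0 // ltW.
have z1r : cabs z1 < r by rewrite /r; lra.
have r_gt0 : 0 < r by apply: le_lt_trans z1r; exact: cabs_ge0.
have f_small z : z \notin S -> r <= cabs z -> cabs (f z) <= e.
  move=> zS rz; have z_gt0 : 0 < 1 + cabs z by apply: lt_le_trans (ge1 z).
  rewrite -(ler_pM2r z_gt0) (le_trans (fK _ zS)) //.
  rewrite mulrC -ler_pdivrMr //; move: rz; rewrite /r; have := cabs_ge0 z1; lra.
pose p := \prod_(s <- S) ('X - s%:P).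
pose B := \prod_(s <- S) (2 * r + cabs s).
have pS z : z \in S -> p.[z] = 0 by move=> zS; apply/eqP; rewrite -rootE root_prod_XsubC.
have B_ge0 : 0 <= B.
  by apply: prodr_ge0 => s _; rewrite addr_ge0 ?cabs_ge0 ?mulr_ge0 // ltW.
have pB z : cabs z <= 2 * r -> cabs p.[z] <= B.
  move=> zr; rewrite horner_prod cabs_prod; apply: ler_prod => s _.
  rewrite cabs_ge0 /= !hornerE (le_trans (cabsB _ _)) // lerD2r //.
have pz1 : 0 < cabs p.[z1] by rewrite cabs_gt0 -rootE root_prod_XsubC.
have bound n : cabs (f z1 ^+ n.+1 * p.[z1]) <= e ^+ n.+1 * B.
  pose h z := f z ^+ n.+1 * p.[z].
  have h2 z : z \notin S -> taylor 2 (fun w => h (z + w)).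
    by move=> zS; apply: taylorM (taylorX _ (f2 _ zS)) (taylor_horner _ (taylor_shift _ _)).
  apply: (@maximum_principle _ h r) z1r => [z|z|z].
  - have [zS|zS] := boolP (z \in S); last first.
      exact: (@taylor_continuous _ 2 _ (h2 _ zS)).
    have hz : h z = 0 by rewrite /h pS // mulr0.
    apply/continuous_cabsP => d d_gt0; rewrite addr0 hz.
    have K1 : 0 < 1 + K ^+ n.+1 by rewrite ltr_wpDr // exprn_ge0.
    have /continuous_cabsP pc := taylor_continuous (taylor_horner p (taylor_shift 2 z)).
    have := pc (d / (1 + K ^+ n.+1)); rewrite divr_gt0 // => /(_ isT).
    apply: filterS => w0; rewrite addr0 (pS z) // !subr0 ltr_pdivlMr // /h; set w :=
      z + w0 => wd.
    have [wS|wS] := boolP (w \in S); first by rewrite pS // mulr0 cabs0.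
    apply: le_lt_trans wd; rewrite cabsM mulrC ler_wpM2l ?cabs_ge0 // cabsX.
    apply: (@le_trans _ _ (K ^+ n.+1)); last by rewrite lerDr.
    apply: lerXn2r; rewrite ?nnegrE ?cabs_ge0 //.
    by apply: le_trans (fK _ wS); rewrite ler_peMr ?cabs_ge0.
  - move=> hz; have zS : z \notin S by apply: contraNN hz => /pS; rewrite /h => ->;
    rewrite mulr0.
    exact: h2.
  - move=> /andP[rz zr]; rewrite /h cabsM.
    have [zS|zS] := boolP (z \in S).
      by rewrite pS // cabs0 mulr0 mulr_ge0 // exprn_ge0 // ltW.
    apply: ler_pM; rewrite ?cabs_ge0 ?pB // cabsX.
    by apply: lerXn2r; rewrite ?nnegrE ?cabs_ge0 ?f_small // ltW.
have fz1E : cabs (f z1) = 2 * e by rewrite /e; lra.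
pose n := Num.bound (B / cabs p.[z1]).
have nB : B / cabs p.[z1] < n%:R by apply: archi_boundP; rewrite divr_ge0 // cabs_ge0.
have := bound n; rewrite cabsM cabsX fz1E exprMn.
rewrite [_ * e ^+ _]mulrC -mulrA ler_pM2l ?exprn_gt0 // -ler_pdivlMr // leNgt => /negP;
  apply.
apply: lt_le_trans nB _; rewrite -natrX ler_nat.
by apply: ltnW; apply: ltn_trans (ltnSn n) _; exact: ltn_expl.
Qed.

(** Liouville's theorem with removable singularities. The difference quotient of [f]
    at a point [p] grows one degree less and has one more singularity, [p], where it is
    bounded; after [D] steps the quotient tends to 0 at infinity, hence vanishes. *)
Lemma polynomial_of_growth D f S (K : R) :
  (forall z, z \notin S -> taylor 2 (fun w => f (z + w))) ->
  (forall z, z \notin S -> cabs (f z) * (1 + cabs z) <= K * (1 + cabs z) ^+ D) ->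
  exists2 q : {poly C}, (size q <= D)%N & forall z, z \notin S -> f z = q.[z].
Proof.
elim: D f S K => [|D IHD] f S K f2 fK.
  exists 0 => [|z zS]; first by rewrite size_poly0.
  rewrite horner0; apply: (decaying_eq0 f2 (K := K)) zS => w wS.
  by have := fK w wS; rewrite expr0 mulr1.
have [p pS] : exists p, p \notin S.
  exists (toC (1 + \sum_(s <- S) cabs s)); apply/negP => pS.
  have : cabs (toC (1 + \sum_(s <- S) cabs s)) <= \sum_(s <- S) cabs s.
    by rewrite [leRHS](big_rem _ pS) /= lerDl sumr_ge0 // => s _; exact: cabs_ge0.
  rewrite cabs_toC ger0_norm ?addr_ge0 ?sumr_ge0 // => [|s _]; last exact: cabs_ge0.
  by rewrite gerDr ler10.
have ge1 z : 1 <= 1 + cabs z by rewrite lerDl cabs_ge0.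
have gt0 z : 0 < 1 + cabs z by apply: lt_le_trans (ge1 z).
have geX z : 1 <= (1 + cabs z) ^+ D by rewrite exprn_ege1.
pose g z := (f z - f p) / (z - p).
have g2 z : z \notin p :: S -> taylor 2 (fun w => g (z + w)).
  rewrite inE negb_or => /andP[zp zS]; apply: taylorM.
    by apply: taylorD (f2 _ zS) (taylor_cst _ _).
  apply: taylorV; first by rewrite addr0 subr_eq0.
  by apply: taylorD (taylor_shift _ _) (taylor_cst _ _).
have [K' gK] : exists K' : R, forall z, z \notin p :: S ->
    cabs (g z) * (1 + cabs z) <= K' * (1 + cabs z) ^+ D.
  have [g1 kg1 fE] := f2 _ pS.
  have /continuous_cabsP/(_ _ ltr01)/near_cabsP[d1 d1_gt0 g1d] :=
    @taylor_continuous _ 1 _ kg1.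
  have /near_cabsP[d2 d2_gt0 fd] := fE.
  pose d := Num.min 1 (Num.min d1 d2).
  have d_gt0 : 0 < d by rewrite !lt_min ltr01 d1_gt0.
  have K_ge0 : 0 <= K.
    have := fK _ pS; rewrite -ler_pdivrMr ?exprn_gt0 //; apply: le_trans.
    by rewrite mulr_ge0 ?invr_ge0 ?exprn_ge0 // ?mulr_ge0 ?cabs_ge0 // ltW.
  pose A := (1 + cabs p) / d + 1.
  have A_ge0 : 0 <= A by rewrite addr_ge0 // divr_ge0 // ltW.
  pose M := (cabs (g1 0) + 1) * (2 + cabs p).
  have M_ge0 : 0 <= M by rewrite mulr_ge0 // addr_ge0 // cabs_ge0.
  have N_ge0 : 0 <= (K + cabs (f p)) * A by rewrite mulr_ge0 // addr_ge0 // cabs_ge0.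
  exists (M + (K + cabs (f p)) * A) => z; rewrite inE negb_or => /andP[zp zS].
  have zp0 : 0 < cabs (z - p) by rewrite cabs_gt0 subr_eq0.
  have zE : cabs z <= cabs p + cabs (z - p).
    by rewrite -{1}(subrK p z) addrC cabsD.
  have [zd|zd] := ltP (cabs (z - p)) d.
    move: zd; rewrite !lt_min => /and3P[zd1 zd2 zd3].
    have gz : g z = g1 (z - p).
      have := fd (z - p); rewrite subr0 addr0 [p + _]addrC subrK => /(_ zd3) fz.
      by rewrite /g fz [f p + _]addrC addrK mulrC mulKf // subr_eq0.
    have gM : cabs (g z) <= cabs (g1 0) + 1.
      rewrite gz; have := g1d (z - p); rewrite subr0 => /(_ zd2) H.
      by rewrite -(subrK (g1 0) (g1 _)) (le_trans (cabsD _ _)) // addrC lerD2l ltW.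
    apply: (@le_trans _ _ M).
      by apply: ler_pM; rewrite ?cabs_ge0 ?(ltW (gt0 _)) //; lra.
    apply: (@le_trans _ _ (M * (1 + cabs z) ^+ D)); first by rewrite ler_peMr.
    by rewrite ler_wpM2r ?lerDl // exprn_ge0 // ltW.
  apply: (@le_trans _ _ ((K + cabs (f p)) * A * (1 + cabs z) ^+ D)); last first.
    by rewrite ler_wpM2r ?lerDr // exprn_ge0 // ltW.
  have zA : (1 + cabs z) / cabs (z - p) <= A.
    rewrite ler_pdivrMr // mulrDl mul1r.
    have : 1 + cabs p <= (1 + cabs p) / d * cabs (z - p).
      by rewrite mulrAC ler_pdivlMr // ler_wpM2l // ltW.
    by lra.
  have fz : cabs (f z) <= K * (1 + cabs z) ^+ D.
    by have := fK _ zS; rewrite exprSr mulrA ler_pM2r.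
  have fzp : cabs (f z - f p) <= (K + cabs (f p)) * (1 + cabs z) ^+ D.
    by rewrite mulrDl (le_trans (cabsB _ _)) // lerD // ler_peMr // cabs_ge0.
  rewrite cabsM cabsV mulrAC -mulrA [_ * A * _]mulrAC.
  by apply: ler_pM => //; rewrite ?cabs_ge0 // divr_ge0 ?cabs_ge0 // ltW.
have [q sq gq] := IHD g (p :: S) K' g2 gK.
exists ((f p)%:P + ('X - p%:P) * q) => [|z zS].
  rewrite (leq_trans (size_polyD _ _)) // geq_max (leq_trans (size_polyC_leq1 _)) //=.
  have [->|q0] := eqVneq q 0; first by rewrite mulr0 size_poly0.
  by rewrite size_monicM ?monicXsubC // size_XsubC.
rewrite !hornerE; have [->|zp] := eqVneq z p; first by rewrite subrr mul0r addr0.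
rewrite -gq ?inE ?negb_or ?zp // /g mulrC divfK ?subr_eq0 //.
by rewrite addrC subrK.
Qed.
End Liouville.

(** * The roots of the equation at a regular point *)

Section Roots.
Variables (R : realType) (N : nat) (P : {poly mpoly N (Cplx R)}).
Hypothesis P_gt1 : (1 < size P)%N.
Local Notation C := (Cplx R).
Local Notation CN := 'rV[C]_N.
Local Notation n := (size P).-1.
Implicit Types (x : CN) (eta : 'I_n -> C).

Definition leading x : C := meval (x 0) (lead_coef P).

Definition enumerates_roots x eta : Prop :=
  equation_at P x = leading x *: \prod_i ('X - (eta i)%:P) /\ injective eta.

Lemma pchar_mpoly (M : nat) : [pchar mpoly M C] =i pred0.
Proof.
move=> p; apply/negbTE/negP => /andP[p_prime /eqP p0].
have := congr1 (meval (fun=> 0)) p0; rewrite rmorph_nat rmorph0 => /eqP.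
by rewrite pnatr_eq0; apply/negP; rewrite -lt0n prime_gt0.
Qed.

Lemma regular_leading x : ~ Sigma P x -> leading x != 0.
Proof.
by move=> Sx; apply/negP => /eqP x0; apply: Sx;
  rewrite /Sigma /= mevalM -/(leading x) x0 mul0r.
Qed.

Lemma size_equation_at x : ~ Sigma P x -> size (equation_at P x) = size P.
Proof. by move=> /regular_leading x0; rewrite size_map_poly_id0. Qed.

Lemma lead_coef_equation_at x :
  ~ Sigma P x -> lead_coef (equation_at P x) = leading x.
Proof. by move=> /regular_leading x0; rewrite lead_coef_map_id0 // rmorph0. Qed.

(** The resultant of [P] and its derivative is a combination of both, so a common root
    at [x] would annihilate it, and with it the discriminant, at [x]. *)
Lemma regular_simple_root x y : (2 < size P)%N -> ~ Sigma P x ->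
  (equation_at P x).[y] = 0 -> (equation_at P x)^`().[y] != 0.
Proof.
move=> P3 Sx y0; apply/negP => /eqP y1; apply: Sx.
have P2 : (1 < size P^`())%N.
  have [m Pm] : exists m, size P = m.+3 by exists (size P - 3)%N; rewrite -addn3 subnK.
  rewrite ltnNge; apply/negP => /leq_sizeP/(_ m.+1 isT)/eqP.
  have -> : P^`()`_m.+1 = lead_coef P *+ m.+2 by rewrite coef_deriv /lead_coef Pm.
  rewrite -mulr_natr mulf_eq0 lead_coef_eq0 -size_poly_eq0 Pm /=.
  by rewrite (pcharf0P _).1 //; exact: pchar_mpoly.
have [[u v] _ /= uv] := resultant_in_ideal P_gt1 P2.
rewrite /Sigma /= discriminantE //; last exact: pchar_mpoly.
rewrite mevalM.
have := congr1 (fun p => (map_poly (meval (x 0)) p).[y]) uv.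
rewrite map_polyC hornerC rmorphD !rmorphM /= hornerD !hornerM.
rewrite -/(equation_at P x) y0 -deriv_map -/(equation_at P x) y1 !mulr0 addr0 => ->.
by rewrite mulr0.
Qed.

Lemma regular_enumeration x : ~ Sigma P x -> exists eta, enumerates_roots x eta.
Proof.
move=> Sx; have [r rE] := closed_field_poly_normal (equation_at P x).
rewrite lead_coef_equation_at // in rE.
have sr : size r = n.
  have := size_equation_at Sx; rewrite rE size_scale ?regular_leading //.
  by rewrite size_prod_XsubC => <-.
pose eta (i : 'I_n) := r`_i.
have etaE : equation_at P x = leading x *: \prod_i ('X - (eta i)%:P).
  by rewrite {1}rE (big_nth 0) big_mkord sr.
exists eta; split=> // i j ij; apply/eqP; apply: contraT => i_neq_j.
have P3 : (2 < size P)%N.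
  rewrite ltn_neqAle P_gt1 andbT; apply/negP => /eqP P2.
  have k0 (k : 'I_n) : k = 0%N :> nat.
    by apply/eqP; rewrite -leqn0 -ltnS -[X in (_ < X)%N](congr1 predn (esym P2)).
  by case/negP: i_neq_j; apply/eqP/val_inj; rewrite /= !k0.
have PE : equation_at P x = leading x *: (('X - (eta i)%:P) * (('X - (eta i)%:P) *
    \prod_(k | (k != i) && (k != j)) ('X - (eta k)%:P))).
  by rewrite etaE (bigD1 i) //= (bigD1 j) 1?eq_sym //= ij.
move: PE; set L := 'X - _; set Q := \prod_(_ | _) _ => PE.
have L0 p : (L * p).[eta i] = 0 by rewrite hornerM hornerXsubC subrr mul0r.
have := @regular_simple_root x (eta i) P3 Sx.
rewrite PE derivZ !hornerZ derivM hornerD !L0 mulr0 addr0 => /(_ erefl).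
by rewrite mulrCA L0 mulr0 eqxx.
Qed.

Lemma enumerates_horner x eta y : enumerates_roots x eta ->
  (equation_at P x).[y] = leading x * \prod_i (y - eta i).
Proof.
case=> -> _; rewrite hornerZ horner_prod; congr (_ * _).
by apply: eq_bigr => i _; rewrite hornerXsubC.
Qed.

Lemma enumerates_root x eta i :
  enumerates_roots x eta -> (equation_at P x).[eta i] = 0.
Proof.
by move=> /enumerates_horner ->; rewrite (bigD1 i) //= subrr mul0r mulr0.
Qed.

Lemma root_enumerated x eta y : ~ Sigma P x -> enumerates_roots x eta ->
  (equation_at P x).[y] = 0 -> exists i, y = eta i.
Proof.
move=> /regular_leading x0 /enumerates_horner -> /eqP.
rewrite mulf_eq0 (negbTE x0) /= prodf_seq_eq0 => /hasP[i _ /=].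
by rewrite subr_eq0 => /eqP ->; exists i.
Qed.

Lemma distinct_roots_enumerate x eta : ~ Sigma P x -> injective eta ->
  (forall i, (equation_at P x).[eta i] = 0) -> enumerates_roots x eta.
Proof.
move=> Sx inj_eta eta0; split=> //.
have [zeta zetaP] := regular_enumeration Sx.
have [s sE] := choice (fun i => root_enumerated Sx zetaP (eta0 i)).
have inj_s : injective s by move=> i j ij; apply: inj_eta; rewrite !sE ij.
rewrite zetaP.1; congr (_ *: _); rewrite (reindex_inj inj_s) /=.
by apply: eq_bigr => i _; rewrite sE.
Qed.

Lemma enumerations_permuted x eta zeta : ~ Sigma P x ->
  enumerates_roots x eta -> enumerates_roots x zeta ->
  exists s : 'S_n, forall i, zeta i = eta (s i).
Proof.
move=> Sx etaP zetaP.
have [s sE] := choice (fun i => root_enumerated Sx etaP (enumerates_root i zetaP)).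
have inj_s : injective s by move=> i j ij; apply: zetaP.2; rewrite !sE ij.
by exists (perm inj_s) => i; rewrite permE.
Qed.

Lemma enumerates_perm x eta (s : 'S_n) :
  enumerates_roots x eta -> enumerates_roots x (fun i => eta (s i)).
Proof.
case=> xE inj_eta; split=> [|i j /inj_eta/perm_inj //].
by rewrite xE; congr (_ *: _); rewrite (reindex_inj (@perm_inj _ s)).
Qed.
End Roots.

Arguments enumerates_roots {R N} P x eta.
Arguments leading {R N} P x.

(** * Classes of functions closed under sums and products *)

Section FunctionClasses.
Variable K : comNzRingType.

(** Continuity, differentiability, expansions of finite order and polynomial growth of
    polynomial expressions are all obtained from this induction. *)
Lemma meval_closed (T : Type) (m : nat) (Q : (T -> K) -> Prop) (v : T -> 'I_m -> K) :
  (forall c, Q (fun=> c)) ->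
  (forall f g, Q f -> Q g -> Q (fun t => f t + g t)) ->
  (forall f g, Q f -> Q g -> Q (fun t => f t * g t)) ->
  (forall i, Q (v^~ i)) ->
  forall p : mpoly m K, Q (fun t => meval (v t) p).
Proof.
move=> Qc QD QM Qv p.
have Qprod (s : seq 'I_m) (e : 'I_m -> nat) : Q (fun t => \prod_(i <- s) v t i ^+ e i).
  elim: s => [|i s IHs].
    by under [X in Q X]eq_fun do rewrite big_nil.
  under [X in Q X]eq_fun do rewrite big_cons.
  apply: (QM) IHs; elim: (e i) => [|k IHk];
    first by under [X in Q X]eq_fun do rewrite expr0.
  by under [X in Q X]eq_fun do rewrite exprS; apply: (QM).
under [X in Q X]eq_fun do rewrite mevalE.
elim: (msupp p) => [|mm s IHs]; first by under [X in Q X]eq_fun do rewrite big_nil.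
by under [X in Q X]eq_fun do rewrite big_cons; apply: (QD) IHs; apply: (QM).
Qed.

Lemma horner_mpoly_closed (T : Type) (m : nat) (Q : (T -> K) -> Prop)
    (v : T -> 'I_m -> K) (f : T -> K) :
  (forall c, Q (fun=> c)) ->
  (forall f g, Q f -> Q g -> Q (fun t => f t + g t)) ->
  (forall f g, Q f -> Q g -> Q (fun t => f t * g t)) ->
  (forall i, Q (v^~ i)) -> Q f ->
  forall p : {poly mpoly m K}, Q (fun t => (map_poly (meval (v t)) p).[f t]).
Proof.
move=> Qc QD QM Qv Qf p; elim/poly_ind: p => [|p c IHp].
  by under [X in Q X]eq_fun do rewrite rmorph0 horner0.
under [X in Q X]eq_fun do rewrite rmorphD rmorphM /= map_polyX map_polyC hornerMXaddC.
by apply: (QD); [apply: (QM)|apply: (meval_closed Qc QD QM Qv c)].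
Qed.
End FunctionClasses.

(** Since [u x = 0], the increment of [v] enters only at second order, and mere
    continuity of [v] suffices: the differential of [f] is [v x] times that of [u]. *)
Lemma differentiable_scale_vanishing (K : numFieldType) (V W : normedModType K)
    (f u : V -> W) (v : V -> K) (x : V) :
  (\forall y \near x, f y = f x + v y *: u y) ->
  differentiable u x -> u x = 0 -> v @ x --> v x -> differentiable f x.
Proof.
move=> fE du ux vx.
have duc : continuous ('d u x) by exact: diff_continuous.
pose L : {linear V -> W} := v x \*: 'd u x.
have Lc : continuous L by move=> h; apply: continuousZl_tmp; exact: duc.
have sh : (fun h : V => h + x) @ (0 : V) --> x.
  by rewrite -[X in _ --> X]add0r; apply: cvgD; [exact: cvg_id|exact: cvg_cst].
have E : f \o shift x = cst (f x) + L +o_ 0 id.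
  apply/eqaddoP => e e_gt0.
  have [k k_gt0 kd] := linear_lipschitz duc.
  pose m := `|v x| + 1.
  have m_gt0 : 0 < m by rewrite ltr_wpDl.
  have /diff_locally/eqaddoE/eqaddoP uE := du.
  have n1 := uE (e / 2 / m); have {n1} := n1 _.
  rewrite !divr_gt0 // => /(_ isT) n1.
  have n2 : \forall h \near (0 : V), `|v x - v (h + x)| < 1.
    exact: (sh _ (cvgr_dist_lt _ _ vx _ ltr01)).
  have ek : 0 < e / 2 / k by rewrite !divr_gt0.
  have n3 : \forall h \near (0 : V), `|v x - v (h + x)| < e / 2 / k.
    exact: (sh _ (cvgr_dist_lt _ _ vx _ ek)).
  have n4 : \forall h \near (0 : V), f (h + x) = f x + v (h + x) *: u (h + x).
    exact: (sh _ fE).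
  near=> h.
  have h3 : `|v x - v (h + x)| < e / 2 / k by near: h.
  have h1 : `|u (h + x) - 'd u x h| <= e / 2 / m * `|h|.
    rewrite -(add0r ('d u x h)) -ux; near: h; exact: n1.
  have vm : `|v (h + x)| <= m.
    rewrite /m -(subrK (v x) (v (h + x))) addrC (le_trans (ler_normD _ _)) // lerD2l.
    by rewrite distrC ltW //; near: h.
  have -> : (f \o shift x - (cst (f x) + L)) h =
      v (h + x) *: (u (h + x) - 'd u x h) + (v (h + x) - v x) *: 'd u x h.
    rewrite /L !fctE /=.
    have -> : f (h + x) = f x + v (h + x) *: u (h + x) by near: h.
    by rewrite opprD addrACA subrr add0r scalerBr scalerBl addrA subrK.
  rewrite (le_trans (ler_normD _ _)) // !normrZ [e in leRHS]splitr mulrDl lerD //.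
    apply: (@le_trans _ _ (m * (e / 2 / m * `|h|))).
      by apply: ler_pM.
    by rewrite mulrA mulrCA divff ?mulr1 ?gt_eqF.
  apply: (@le_trans _ _ (e / 2 / k * (k * `|h|))).
    by apply: ler_pM => //; rewrite distrC ltW.
  by rewrite mulrA divfK ?gt_eqF.
have dE : 'd f x = L :> (V -> W) by apply: diff_unique.
by apply/diff_locallyP; rewrite dE.
Unshelve. all: by end_near.
Qed.

Section Differentiability.
Variables (R : realType) (N : nat).
Local Notation C := (Cplx R).
Local Notation CN := 'rV[C]_N.
Implicit Types (f g u v : CN -> C) (x : CN).

Lemma continuous_meval (p : mpoly N C) x :
  (fun y : CN => meval (y 0) p) @ x --> meval (x 0) p.
Proof.
apply: (@meval_closed _ CN N (fun f => f @ x --> f x) (fun y => y 0)) => [c|f g|f g|i].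
- exact: (differentiable_continuous (differentiable_cst c x)).
- by move=> fx gx; apply: cvgD fx gx.
- by move=> fx gx; apply: cvgM fx gx.
- exact: (differentiable_continuous (differentiable_coord _ _ _)).
Qed.

Lemma differentiable_horner (P : {poly mpoly N C}) y x :
  differentiable (fun z : CN => (equation_at P z).[y]) x.
Proof.
apply: (@horner_mpoly_closed _ CN N (fun f => differentiable f x) (fun y => y 0) (fun=>
  y)) => [c|f g|f g|i|].
- exact: differentiable_cst.
- exact: differentiableD.
- exact: differentiableM.
- exact: differentiable_coord.
- exact: differentiable_cst.
Qed.

Lemma differentiable_vanishing_mul f u v x :
  (\forall y \near x, f y = f x + u y * v y) ->
  differentiable u x -> u x = 0 -> v @ x --> v x -> differentiable f x.
Proof.
move=> fE; apply: differentiable_scale_vanishing.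
by apply: filterS fE => y ->; rewrite mulrC.
Qed.
End Differentiability.

(** * Local labellings of the roots *)

Section Charts.
Variables (R : realType) (N : nat) (P : {poly mpoly N (Cplx R)}).
Hypothesis P_gt1 : (1 < size P)%N.
Local Notation C := (Cplx R).
Local Notation CN := 'rV[C]_N.
Local Notation n := (size P).-1.
Implicit Types (x c : CN) (eta : 'I_n -> C) (e : C) (h : 'I_n -> CN -> C).

Lemma cvg_near_cabs (f : CN -> C) x (y : C) (e : R) : f @ x --> y -> 0 < e ->
  \forall x' \near x, cabs (f x' - y) < e.
Proof.
move=> fx e_gt0; have e_gt0' : 0 < toC e by rewrite -toC0 ltc_toC.
apply: filterS (cvgr_dist_lt _ _ fx _ e_gt0') => x'.
by rewrite distrC normC_cabs ltc_toC.
Qed.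

Lemma cvg_prod_cond (I : Type) (r : seq I) (Q : pred I) (F : I -> CN -> C) x :
  (forall i, F i @ x --> F i x) ->
  (fun y => \prod_(i <- r | Q i) F i y) @ x --> \prod_(i <- r | Q i) F i x.
Proof.
move=> Fx; elim: r => [|i r IHr].
  under [X in X @ _ --> _]eq_fun do rewrite big_nil.
  by rewrite big_nil; exact: (differentiable_continuous (differentiable_cst (1 : C) x)).
rewrite big_cons; under [X in X @ _ --> _]eq_fun do rewrite big_cons.
case: (Q i); [exact: cvgM (Fx i) IHr|exact: IHr].
Qed.

Lemma near_regular x : ~ Sigma P x -> \forall x' \near x, ~ Sigma P x'.
Proof.
move=> /eqP; rewrite -cabs_gt0 => Sx.
apply: filterS (cvg_near_cabs (@continuous_meval _ _ (lead_coef P * discriminant P) x) Sx) => x' /[swap]; rewrite /Sigma /= => ->.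
by rewrite sub0r cabsN ltxx.
Qed.

(** Continuity of roots: [P_x'(eta i)] is small for [x'] near [x], and it is the product
    of the leading coefficient by the [n] distances from [eta i] to the roots at [x'],
    which cannot all be at least [d]. *)
Lemma roots_nearby x eta (d : R) : ~ Sigma P x -> enumerates_roots P x eta -> 0 < d ->
  \forall x' \near x, forall zeta, enumerates_roots P x' zeta ->
    forall i, exists j, cabs (eta i - zeta j) < d.
Proof.
move=> Sx etaP d_gt0.
have c_gt0 : 0 < cabs (leading P x) by rewrite cabs_gt0 regular_leading.
have c2 : 0 < cabs (leading P x) / 2 by rewrite divr_gt0.
have nc := cvg_near_cabs (@continuous_meval _ _ (lead_coef P) x) c2.
have cd : 0 < cabs (leading P x) / 2 * d ^+ n by rewrite mulr_gt0 // exprn_gt0.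
have nP : \forall x' \near x, forall i, cabs (equation_at P x').[eta i] < cabs (leading P x) / 2 * d ^+ n.
  apply: (@filter_forall CN 'I_n _ (nbhs x) (nbhs_filter x)) => i.
  have nPi := cvg_near_cabs (differentiable_continuous (differentiable_horner P (eta i) x)) cd.
  by apply: filterS nPi => x'; rewrite (enumerates_root i etaP) subr0.
apply: filterS2 nc nP => x' c' P' zeta zetaP i; apply: contrapT => far.
have := P' i; rewrite (enumerates_horner _ zetaP) cabsM cabs_prod ltNge => /negP; apply.
apply: ler_pM; rewrite ?(ltW c2) ?exprn_ge0 ?(ltW d_gt0) //.
  have := cabsB (leading P x') (leading P x' - leading P x); rewrite subKr.
  have : cabs (leading P x' - leading P x) < cabs (leading P x) / 2 by [].
  move: (cabs _) (cabs _) (cabs _); clear => *; lra.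
rewrite -[X in d ^+ X]card_ord -prodr_const; apply: ler_prod => j _.
by rewrite (ltW d_gt0) leNgt; apply/negP => lt; apply: far; exists j.
Qed.

Record root_chart c e h : Prop := RootChart {
  chart_regular : forall x, ball c e x -> ~ Sigma P x;
  chart_roots : forall x, ball c e x -> enumerates_roots P x (h^~ x);
  chart_continuous : forall x i, ball c e x -> h i @ x --> h i x }.

Lemma root_chart_perm c e h (s : 'S_n) :
  root_chart c e h -> root_chart c e (fun i => h (s i)).
Proof.
move=> hC; split=> [x|x ex|x i].
- exact: (chart_regular hC).
- exact: (enumerates_perm s (chart_roots hC ex)).
- exact: (chart_continuous hC).
Qed.

Lemma near_in_ball c e x : ball c e x -> \forall x' \near x, ball c e x'.
Proof. by move=> ex; apply: open_nbhs_nbhs; split; first exact: ball_open. Qed.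

Lemma separation eta : injective eta ->
  exists2 d : R, 0 < d & forall i j, i != j -> 3 * d <= cabs (eta i - eta j).
Proof.
move=> inj_eta.
pose d := \big[Num.min/1]_(p : 'I_n * 'I_n | p.1 != p.2) (cabs (eta p.1 - eta p.2) / 3).
exists d => [|i j ij].
  rewrite /d; elim/big_ind: _ => [|a b a0 b0|[i j] /= ij]; first exact: ltr01.
    by rewrite lt_min a0.
  by rewrite divr_gt0 // cabs_gt0 subr_eq0 (inj_eq inj_eta).
have : d <= cabs (eta i - eta j) / 3 by apply: (@bigmin_le_cond _ _ _ _ (i, j)).
by lra.
Qed.

(** When the roots at [x] are [3 d] apart, nearby points have exactly one root within
    [d] of each of them. This labels the roots, and the label cannot change under a
    further displacement smaller than [d], whence continuity. *)
Lemma root_chart_exists x : ~ Sigma P x -> exists2 e, 0 < e & exists h, root_chart x e h.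
Proof.
move=> Sx; have [eta etaP] := regular_enumeration P_gt1 Sx.
have [d d_gt0 sep] := separation etaP.2.
have [e /= e_gt0 eB] :=
  (nbhs_ballP x _).1 (filterI (near_regular Sx) (roots_nearby Sx etaP d_gt0)).
exists e => //.
pose h i (x' : CN) : C := xget 0 [set y | (equation_at P x').[y] = 0 /\ cabs (eta i - y) < d].
have hP x' i : ball x e x' -> (equation_at P x').[h i x'] = 0 /\ cabs (eta i - h i x') < d.
  move=> ex; have [Sx' near_x'] := eB _ ex.
  have [zeta zetaP] := regular_enumeration P_gt1 Sx'.
  have [j ij] := near_x' _ zetaP i.
  rewrite /h; case: xgetP => [y _ [y0 iy]|]; first by [].
  by move/(_ (zeta j)); case; split=> //; exact: enumerates_root.
have hR x' : ball x e x' -> enumerates_roots P x' (h^~ x').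
  move=> ex; have [Sx' _] := eB _ ex.
  apply: distinct_roots_enumerate => // [i j ij|i]; last by have [] := hP x' i ex.
  apply/eqP; apply: contraT => /sep; rewrite leNgt => /negP; case.
  have [_ iP] := hP x' i ex; have [_ jP] := hP x' j ex.
  have := cabsB (eta i - h i x') (eta j - h j x').
  rewrite ij opprB addrA subrK; move: iP jP; rewrite ij.
  move: (cabs _) (cabs _) (cabs _); clear -d_gt0 => *; lra.
exists h; split=> // [x' /eB[]//|x' i ex].
have [Sx' _] := eB _ ex.
have FF : Filter (nbhs x') := nbhs_filter x'.
apply/cvgrPdist_lt => _ /gt0_toC[r r_gt0 ->].
have m_gt0 : 0 < Num.min r d by rewrite lt_min r_gt0.
have n1 := roots_nearby Sx' (hR _ ex) m_gt0.
apply: filterS2 n1 (near_in_ball ex) => x2 n1 ex2.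
have [j] := n1 _ (hR _ ex2) i; rewrite lt_min => /andP[jr jd].
suff ij : j = i by move: jr; rewrite ij normC_cabs ltc_toC.
apply/eqP; apply: contraT; rewrite eq_sym => /sep; rewrite leNgt => /negP; case.
have [_ iP] := hP x' i ex; have [_ jP] := hP x2 j ex2.
have := cabsB (eta i - h i x' + (h i x' - h j x2)) (eta j - h j x2).
have := cabsD (eta i - h i x') (h i x' - h j x2).
rewrite addrA subrK opprB addrA subrK; move: iP jP jd.
move: (cabs _) (cabs _) (cabs _) (cabs _) (cabs _); clear -d_gt0 => *; lra.
Qed.

Lemma root_chart_through c e h x eta : root_chart c e h -> ball c e x ->
  enumerates_roots P x eta ->
  exists2 g, root_chart c e g & forall i, g i x = eta i.
Proof.
move=> hC ex etaP.
have [s sE] := enumerations_permuted (chart_regular hC ex) (chart_roots hC ex) etaP.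
by exists (fun i => h (s i)); [exact: root_chart_perm|move=> i; rewrite sE].
Qed.

(** All the other roots being away from [h i x], dividing by the corresponding
    factors turns the factorization of [P] at [h i x] into an exact formula for the
    increment of [h i]. *)
Lemma root_increment x eta zeta i : ~ Sigma P x -> enumerates_roots P x zeta ->
  (forall j, j != i -> eta i - zeta j != 0) ->
  zeta i = eta i - (equation_at P x).[eta i] *
    (leading P x * \prod_(j | j != i) (eta i - zeta j))^-1.
Proof.
move=> Sx zetaP ij0; rewrite (enumerates_horner _ zetaP) (bigD1 i) //= mulrCA mulfK.
  by rewrite subKr.
rewrite mulf_neq0 ?regular_leading //.
by apply/prodf_neq0 => j; exact: ij0.
Qed.

Lemma chart_other_roots c e h x i : root_chart c e h -> ball c e x ->
  \forall x' \near x, forall j, j != i -> h i x - h j x' != 0.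
Proof.
move=> hC ex; apply: (@filter_forall CN 'I_n _ (nbhs x) (nbhs_filter x)) => j.
have [ji|ji] := eqVneq j i; first by apply: filterE => x' /eqP.
have d_gt0 : 0 < cabs (h i x - h j x).
  by rewrite cabs_gt0 subr_eq0 (inj_eq (chart_roots hC ex).2) eq_sym.
apply: filterS (cvg_near_cabs (@chart_continuous _ _ _ hC x j ex) d_gt0) => x' lt _;
  apply/negP; rewrite subr_eq0 => /eqP ij.
by move: lt; rewrite -ij ltxx.
Qed.

(** In [root_increment] the numerator is polynomial in the point and vanishes at [x],
    and the denominator is continuous and nonzero at [x]. *)
Lemma chart_analytic c e h x i : root_chart c e h -> ball c e x -> differentiable (h i) x.
Proof.
move=> hC ex.
pose u (x' : CN) := - (equation_at P x').[h i x].
pose v (x' : CN) := (leading P x' * \prod_(j | j != i) (h i x - h j x'))^-1.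
apply: (@differentiable_vanishing_mul _ _ (h i) u v).
- apply: filterS2 (near_in_ball ex) (chart_other_roots i hC ex) => x' ex' ij0.
  rewrite /u /v mulNr.
  exact: (root_increment (eta := h^~ x) (chart_regular hC ex') (chart_roots hC ex') ij0).
- by apply: differentiableN; exact: differentiable_horner.
- by rewrite /u (enumerates_root _ (chart_roots hC ex)) oppr0.
have FF : Filter (nbhs x) := nbhs_filter x.
apply: cvgV.
  rewrite mulf_neq0 ?(regular_leading (chart_regular hC ex)) //.
  apply/prodf_neq0 => j ji.
  by rewrite subr_eq0 (inj_eq (chart_roots hC ex).2) eq_sym.
apply: cvgM; first exact: continuous_meval.
apply: cvg_prod_cond => j.
have hj := @chart_continuous _ _ _ hC x j ex.
exact: cvgB (differentiable_continuous (differentiable_cst (h i x) x)) hj.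
Qed.
End Charts.
Arguments root_chart {R N} P c e h.

(** * Continuation of the roots and monodromy *)

Section Continuation.
Variables (R : realType) (N : nat) (P : {poly mpoly N (Cplx R)}).
Hypothesis P_gt1 : (1 < size P)%N.
Local Notation C := (Cplx R).
Local Notation CN := 'rV[C]_N.
Local Notation n := (size P).-1.
Implicit Types (a c x y z : CN) (eta zeta xi : 'I_n -> C) (e : C)
  (h : 'I_n -> CN -> C) (f g : CN -> C) (t u T : R).

Lemma chart_germ c e h x i : root_chart P c e h -> ball c e x -> germ_of_y P x (h i).
Proof.
move=> hC ex; split; apply: filterS (near_in_ball ex) => y ey.
  exact: chart_analytic hC ey.
exact: enumerates_root (chart_roots hC ey).
Qed.

Lemma germ_of_y_continuous a f : germ_of_y P a f -> f @ a --> f a.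
Proof. by move=> [/nbhs_singleton df _]; exact: differentiable_continuous df. Qed.

Lemma germ_of_y_root a f : germ_of_y P a f -> (equation_at P a).[f a] = 0.
Proof. by move=> [_ /nbhs_singleton]. Qed.

(** The roots over a regular point are separated, so that a continuous root cannot
    jump from one to another. *)
Lemma germ_of_y_unique a f g : ~ Sigma P a -> germ_of_y P a f -> germ_of_y P a g ->
  f a = g a -> germ_eq a f g.
Proof.
move=> Sa fy gy fga.
have [e e_gt0 [h hC]] := root_chart_exists P_gt1 Sa.
have ea : ball a e a by exact: ballxx.
have [i fi] := root_enumerated Sa (chart_roots hC ea) (germ_of_y_root fy).
have [d d_gt0 sep] := separation (chart_roots hC ea).2.
have near_h : \forall x \near a, forall j, cabs (h j x - h j a) < d.
  apply: (@filter_forall CN 'I_n _ (nbhs a) (nbhs_filter a)) => j.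
  exact: cvg_near_cabs (@chart_continuous _ _ _ _ _ _ hC a j ea) d_gt0.
have to_h k : germ_of_y P a k -> k a = h i a -> \forall x \near a, k x = h i x.
  move=> ky ki.
  have near_k := cvg_near_cabs (germ_of_y_continuous ky) d_gt0.
  have in_ball := near_in_ball ea; have [_ k0] := ky.
  apply: filterS3 (filterI near_h near_k) in_ball k0 => x [hd kd] ex k0.
  have [j kj] := root_enumerated (chart_regular hC ex) (chart_roots hC ex) k0.
  suff -> : i = j by [].
  apply/eqP; apply: contraT => /sep; rewrite leNgt => /negP; case.
  have := cabsB (h j x - h j a) (k x - k a).
  rewrite -ki kj opprB addrC addrA subrK => jk.
  apply: le_lt_trans jk _; have := hd j; move: kd; rewrite kj.
  move: (cabs _) (cabs _); clear -d_gt0 => *; lra.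
apply: filterS2 (to_h f fy fi) (to_h g gy _) => [x -> ->|]; first by [].
by rewrite -fga.
Qed.

(** Continuation is carried on points of the space of labellings of the roots, i.e. of
    pairs [(x, eta)]: as the roots are simple, the value of a root determines its germ.
    This makes continuation a symmetric relation, which commutes with relabelling. *)
Definition chart_step x eta y zeta : Prop := exists c e h,
  [/\ root_chart P c e h, ball c e x, ball c e y, eta = h^~ x & zeta = h^~ y].

Inductive linked : CN -> ('I_n -> C) -> CN -> ('I_n -> C) -> Prop :=
| linked_refl x eta of ~ Sigma P x & enumerates_roots P x eta : linked x eta x eta
| linked_step x eta y zeta z xi of linked x eta y zeta & chart_step y zeta z xi :
    linked x eta z xi.

Lemma chart_step_sym x eta y zeta : chart_step x eta y zeta -> chart_step y zeta x eta.
Proof. by move=> [c [e [h [hC ex ey xE yE]]]]; exists c, e, h. Qed.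

Lemma chart_step_linked x eta y zeta : chart_step x eta y zeta -> linked x eta y zeta.
Proof.
move=> st; have [c [e [h [hC ex ey xE yE]]]] := st; apply: linked_step st.
by apply: linked_refl; [exact: (chart_regular hC)|rewrite xE; exact: (chart_roots hC)].
Qed.

Lemma linked_trans x eta y zeta z xi :
  linked x eta y zeta -> linked y zeta z xi -> linked x eta z xi.
Proof.
move=> xy yz; elim: yz xy => // {}y {}zeta y' zeta' {}z {}xi _ IH st /IH xy.
exact: linked_step xy st.
Qed.

Lemma linked_sym x eta y zeta : linked x eta y zeta -> linked y zeta x eta.
Proof.
elim=> [{}x {}eta|{}x {}eta {}y {}zeta z xi _ IH st]; first exact: linked_refl.
exact: linked_trans (chart_step_linked (chart_step_sym st)) IH.
Qed.

Lemma linked_regular x eta y zeta : linked x eta y zeta -> ~ Sigma P y.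
Proof.
by case=> // {}x {}eta {}y {}zeta z xi _ [c [e [h [hC _ ez _ _]]]];
  exact: (chart_regular hC).
Qed.

Lemma linked_enumerates x eta y zeta : linked x eta y zeta -> enumerates_roots P y zeta.
Proof.
by case=> // {}x {}eta {}y {}zeta z xi _ [c [e [h [hC _ ez _ ->]]]];
  exact: (chart_roots hC).
Qed.

Lemma linked_perm (s : 'S_n) x eta y zeta : linked x eta y zeta ->
  linked x (fun i => eta (s i)) y (fun i => zeta (s i)).
Proof.
elim=> [{}x {}eta Sx etaP|{}x {}eta {}y {}zeta z xi _ IH].
  by apply: linked_refl => //; exact: enumerates_perm.
move=> [c [e [h [hC ey ez zetaE xiE]]]]; apply: linked_step IH _.
exists c, e, (fun i => h (s i)); split=> //; last by rewrite xiE.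
  exact: root_chart_perm.
by rewrite zetaE.
Qed.

Lemma linked_chart x eta y c e h : root_chart P c e h -> ball c e y ->
  linked x eta y (h^~ y) -> forall z, ball c e z -> linked x eta z (h^~ z).
Proof.
by move=> hC ey xy z ez; apply: linked_step xy _; exists c, e, h.
Qed.

Lemma ball_segment c e y z t : ball c e y -> ball c e z -> 0 <= t <= 1 ->
  ball c e (y + toC t *: (z - y)).
Proof.
rewrite -!ball_normE /= => cy cz /andP[t_ge0 t_le1].
have -> : z - y = (c - y) - (c - z) by rewrite opprB [RHS]addrC addrA subrK.
have -> : c - (y + toC t *: (c - y - (c - z))) =
    (1 - toC t) *: (c - y) + toC t *: (c - z).
  by rewrite opprD addrA scalerBr scalerBl scale1r opprB [toC t *: (c - z) - _]addrC addrA.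
have t0 : 0 <= toC t by rewrite -toC0 lec_toC.
have t1 : 0 <= 1 - toC t by rewrite subr_ge0 -toC1 lec_toC.
rewrite (le_lt_trans (ler_normD _ _)) // !normrZ !ger0_norm //.
have [->|tn0] := eqVneq t 0.
  by rewrite toC0 subr0 mul1r mul0r addr0.
have -> : e = (1 - toC t) * e + toC t * e by rewrite mulrBl mul1r subrK.
rewrite ler_ltD //; first by rewrite ler_wpM2l // ltW.
by rewrite ltr_pM2l // -toC0 ltc_toC lt_def tn0.
Qed.

(** The displacement parameter: 0 on the negative half-line, the identity on the unit
    interval, 1 afterwards. *)
Definition clamp t : R := (1 + `|t| - `|t - 1|) / 2.

Lemma clamp_le0 t : t <= 0 -> clamp t = 0.
Proof. by move=> t0; rewrite /clamp ler0_norm // ler0_norm; lra. Qed.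

Lemma clamp_ge1 t : 1 <= t -> clamp t = 1.
Proof. by move=> t1; rewrite /clamp ger0_norm ?ger0_norm; lra. Qed.

Lemma clamp_in01 t : 0 <= clamp t <= 1.
Proof.
have [t0|t0] := leP t 0; first by rewrite clamp_le0 ?lexx ?ler01.
have [t1|t1] := leP 1 t; first by rewrite clamp_ge1 ?lexx ?ler01.
rewrite /clamp (ger0_norm (ltW t0)) ltr0_norm ?subr_lt0 //; lra.
Qed.

Lemma continuous_clamp : continuous clamp.
Proof.
move=> t; apply: cvgM; last exact: cvg_cst.
apply: cvgB; last first.
  by apply: cvg_norm; apply: cvgB; [exact: cvg_id|exact: cvg_cst].
by apply: cvgD; [exact: cvg_cst|exact: cvg_norm].
Qed.

Lemma continuous_toC : continuous (@toC R).
Proof.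
move=> t; have FF : Filter (nbhs t) := nbhs_filter t.
apply/cvgrPdist_lt => _ /gt0_toC[r r_gt0 ->].
have : \forall s \near t, `|t - s| < r by exact: (@near_ball R R t r r_gt0).
apply: filterS => s st; rewrite normC_cabs ltc_toC.
by have -> : toC t - toC s = toC (t - s); [rewrite /toC rmorphB|rewrite cabs_toC].
Qed.

(** Continuation of a labelling of the roots along a path parametrized by the whole
    line and at rest after time [T]; paths of this form are lengthened by adding a
    displacement that vanishes until [T]. *)
Record continuation T (gamma : R -> CN) (F : R -> 'I_n -> CN -> C)
    x eta y zeta : Prop := Continuation {
  continuation_ge0 : 0 <= T;
  continuation_path : continuous gamma;
  continuation_start : gamma 0 = x;
  continuation_end : forall t, T <= t -> gamma t = y;
  continuation_regular : forall t, ~ Sigma P (gamma t);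
  continuation_germ : forall t i, germ_of_y P (gamma t) (F t i);
  continuation_locally : forall t i,
    \forall s \near t, germ_eq (gamma s) (F s i) (F t i);
  continuation_start_value : forall i, F 0 i x = eta i;
  continuation_end_value : forall i, F T i y = zeta i }.

(** Each step of a chain is followed along a segment, which stays in the ball of its
    chart. *)
Lemma linked_continuation x eta y zeta : linked x eta y zeta ->
  exists T gamma F, continuation T gamma F x eta y zeta.
Proof.
elim=> [{}x {}eta Sx etaP|{}x {}eta {}y {}zeta z xi _ [T [gamma [F cF]]]].
  have [e e_gt0 [h hC]] := root_chart_exists P_gt1 Sx.
  have ex : ball x e x by exact: ballxx.
  have [g gC gx] := root_chart_through hC ex etaP.
  exists 0, (fun=> x), (fun=> g); split=> //.
  - by move=> t; exact: cvg_cst.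
  - by move=> t i; exact: chart_germ gC ex.
  - by move=> t i; apply: filterE => s; apply: filterE.
move=> [c [e [h [hC ey ez zetaE xiE]]]].
pose gamma' t := gamma t + toC (clamp (t - T)) *: (z - y).
pose F' t i := if t <= T then F t i else h i.
have before t : t <= T -> gamma' t = gamma t.
  by move=> tT; rewrite /gamma' clamp_le0 ?subr_le0 // toC0 scale0r addr0.
have after t : T <= t -> ball c e (gamma' t).
  move=> tT; rewrite /gamma' (continuation_end cF) //.
  exact: ball_segment (clamp_in01 _).
have c_gamma' : continuous gamma'.
  move=> t; apply: cvgD; first exact: continuation_path cF t.
  apply: cvgZr_tmp.
  apply: (@cvg_comp _ _ _ (fun t => clamp (t - T)) (@toC R)); last exact: continuous_toC.
  apply: (@cvg_comp _ _ _ (fun t => t - T) clamp); last exact: continuous_clamp.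
  by apply: cvgB; [exact: cvg_id|exact: cvg_cst].
have T_ge0 := continuation_ge0 cF.
have gammaT : gamma T = y by exact: (continuation_end cF).
exists (T + 1), gamma', F'; split.
- by rewrite addr_ge0.
- exact: c_gamma'.
- by rewrite before // (continuation_start cF).
- move=> t tT; rewrite /gamma' (continuation_end cF); last lra.
  by rewrite clamp_ge1 ?toC1 ?scale1r ?[y + _]addrC ?subrK //; lra.
- move=> t; have [tT|/ltW tT] := leP t T.
    by rewrite before //; exact: (continuation_regular cF).
  exact: (chart_regular hC (after _ tT)).
- move=> t i; rewrite /F'; have [tT|/ltW tT] := leP t T.
    by rewrite before //; exact: (continuation_germ cF).
  exact: chart_germ hC (after _ tT).
- move=> t i; have [tT|tT|tT] := ltgtP t T.
  + have ltT : \forall s \near t, s < T by exact: lt_nbhsl.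
    apply: filterS2 ltT (continuation_locally cF t i) => s sT.
    by rewrite /F' (ltW sT) (ltW tT) before // ltW.
  + have gtT : \forall s \near t, T < s by exact: lt_nbhsr.
    apply: filterS gtT => s sT; rewrite /F' !leNgt sT tT /=.
    by apply: filterE.
  (* At the junction, [h i] and the germ reached at time [T] are roots with the same
     value, hence the same germ. *)
  rewrite tT; have hF : germ_eq (gamma' T) (h i) (F T i).
    rewrite before // gammaT; apply: germ_of_y_unique.
    + exact: (chart_regular hC ey).
    + exact: chart_germ hC ey.
    + by rewrite -gammaT; exact: (continuation_germ cF).
    + by rewrite (continuation_end_value cF) zetaE.
  have {}hF : \forall s \near T, germ_eq (gamma' s) (h i) (F T i).
    by move/near_join : hF => hF; exact: (c_gamma' T _ hF).
  apply: filterS2 hF (continuation_locally cF T i) => s hFs FFs.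
  rewrite /F' lexx; case: ifPn => sT; last exact: hFs.
  rewrite (before _ sT); exact: FFs.
- by move=> i; rewrite /F' T_ge0 (continuation_start_value cF).
- by move=> i; rewrite /F' leNgt ltrDl ltr01 /= xiE.
Qed.

(** The path that follows a chain from [x] to [x] is a loop; at both ends the germs are
    identified by their values. *)
Lemma linked_monodromy x eta (Y : 'I_n -> CN -> C) (s : 'S_n) :
  (forall i, germ_of_y P x (Y i)) -> (forall i, Y i x = eta i) ->
  linked x eta x (fun i => eta (s i)) -> s \in monodromy P x Y.
Proof.
move=> Yy Yx /[dup] xx /linked_continuation[T [gamma [F cF]]].
have Sx := linked_regular xx.
rewrite inE; apply/asboolP.
have cT : continuous (fun t => T * t).
  by move=> t; apply: cvgM; [exact: cvg_cst|exact: cvg_id].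
have c_loop : continuous (fun t => gamma (T * t)).
  move=> t; apply: (@cvg_comp _ _ _ (fun t => T * t) gamma); first exact: cT.
  exact: continuation_path cF _.
have g0 : gamma (T * 0) = x by rewrite mulr0 (continuation_start cF).
have g1 : gamma (T * 1) = x by rewrite mulr1 (continuation_end cF).
exists (fun t => gamma (T * t)); split.
  split=> // [|t _]; first exact: continuous_subspaceT.
  exact: (continuation_regular cF).
move=> i; exists (fun t => F (T * t) i); split.
- by move=> t _; have [] := continuation_germ cF (T * t) i.
- rewrite g0 mulr0; apply: germ_of_y_unique => //.
    by rewrite -(continuation_start cF); exact: (continuation_germ cF).
  by rewrite (continuation_start_value cF) Yx.
- rewrite g1 mulr1; apply: germ_of_y_unique => //.
    have <- : gamma T = x by exact: (continuation_end cF).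
    exact: (continuation_germ cF).
  by rewrite (continuation_end_value cF) Yx.
move=> t _.
have H : \forall u \near t, germ_eq (gamma (T * u)) (F (T * u) i) (F (T * t) i).
  exact: (cT t _ (continuation_locally cF (T * t) i)).
by apply: filterS H => u.
Qed.
End Continuation.
Arguments linked {R N} P x eta y zeta.

(** * Separately polynomial functions *)

Section Interpolation.
Variables (K : fieldType) (N : nat).
Implicit Types (x v : 'rV[K]_N) (F : 'rV[K]_N -> K).

Definition update x (k : 'I_N) (a : K) : 'rV[K]_N := \row_j if j == k then a else x 0 j.

Lemma update_id x k : update x k (x 0 k) = x.
Proof. by apply/rowP => j; rewrite mxE; case: eqP => // ->. Qed.

Definition mix m x v : 'rV[K]_N := \row_j if (j < m)%N then v 0 j else x 0 j.

Lemma mixS (k : 'I_N) x v a : update (mix k x v) k a = mix k.+1 x (update v k a).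
Proof.
apply/rowP => j; rewrite !mxE [in RHS]ltnS [in RHS]leq_eqVlt.
have -> : (nat_of_ord j == nat_of_ord k) = (j == k) by [].
by case: (j == k).
Qed.

Definition poly_in_coord (k : 'I_N) (p : {poly K}) : mpoly N K :=
  (map_poly (@mpolyC N K) p).[mpolyX K (mnm1 k)].

Lemma meval_poly_in_coord x k p : meval (x 0) (poly_in_coord k p) = p.[x 0 k].
Proof.
rewrite /poly_in_coord -horner_map /= mevalXU -map_poly_comp /=.
by rewrite (@eq_map_poly _ _ _ id) ?map_poly_id // => c /=; rewrite mevalC.
Qed.

Variables (I : 'I_N -> K -> Prop) (node : 'I_N -> nat -> K).
Hypothesis node_in : forall k j, I k (node k j).
Hypothesis node_inj : forall k, injective (node k).

Lemma lagrange_interpolation D F k x : 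
  (exists2 q : {poly K}, (size q <= D)%N & forall a, I k a -> F (update x k a) = q.[a]) ->
  I k (x 0 k) ->
  F x = \sum_(j < D) F (update x k (node k j)) * (tnth (lagrange D (node k)) j : {poly K}).[x 0 k].
Proof.
move=> [q sq Fq] Ik; rewrite -{1}(update_id x k) Fq //.
case: D sq => [|D] sq; first by move: sq; rewrite leqn0 size_poly_eq0 => /eqP ->;
  rewrite horner0 big_ord0.
rewrite {1}(lagrange_gen (ltn0Sn D) (node_inj (k := k)) sq) horner_sum; apply: eq_bigr =>
  j _.
by rewrite hornerM hornerC Fq.
Qed.

(** Lagrange interpolation in one coordinate expresses [F x] through the values of [F]
    at points where this coordinate is a node. Once all the coordinates have been
    treated, only finitely many values of [F] remain, with polynomial coefficients. *)
Lemma separately_polynomial D F :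
  (forall x k, (forall j, I j (x 0 j)) -> exists2 q : {poly K}, (size q <= D)%N &
     forall a, I k a -> F (update x k a) = q.[a]) ->
  exists p : mpoly N K, forall x, (forall j, I j (x 0 j)) -> F x = meval (x 0) p.
Proof.
move=> sepF.
have interp m : (m <= N)%N -> exists l : seq (mpoly N K * 'rV[K]_N),
    (forall pv, pv \in l -> forall j, I j (pv.2 0 j)) /\
    forall x, (forall j, I j (x 0 j)) ->
      F x = \sum_(pv <- l) meval (x 0) pv.1 * F (mix m x pv.2).
  elim: m => [_|m IHm mN].
    exists [:: (1, \row_k node k 0)]; split=> [pv|x xI].
      by rewrite inE => /eqP -> j; rewrite mxE; exact: node_in.
    rewrite big_seq1 rmorph1 mul1r; congr F.
    by apply/rowP => j; rewrite mxE.
  have [l [lI lF]] := IHm (ltnW mN); pose k := Ordinal mN.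
  pose f (pv : mpoly N K * 'rV[K]_N) (j : 'I_D) :=
    (pv.1 * poly_in_coord k (tnth (lagrange D (node k)) j), update pv.2 k (node k j)).
  exists [seq f pv j | pv <- l, j <- enum 'I_D]; split=>
    [pv /allpairsP[[pv' j] /= [pvl _ ->]] i|x xI].
    by rewrite /f mxE; case: eqP => [->|_]; [exact: node_in|exact: lI].
  rewrite lF // big_allpairs_dep; apply: eq_big_seq => pv pvl.
  rewrite big_enum /= (@lagrange_interpolation D _ k); last first.
  - by rewrite mxE ltnn.
  - apply: sepF => j; rewrite mxE; case: ifP => _ //; exact: lI.
  rewrite mulr_sumr; apply: eq_bigr => j _.
  rewrite mevalM meval_poly_in_coord -(mixS k) mxE ltnn; ring.
have [l [lI lF]] := interp N (leqnn N).
exists (\sum_(pv <- l) F pv.2 *: pv.1) => x xI.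
rewrite lF // raddf_sum; apply: eq_bigr => pv _.
rewrite /= mevalZ mulrC; congr (F _ * _).
by apply/rowP => j; rewrite mxE ltn_ord.
Qed.
End Interpolation.

(** * Polynomial growth of the roots *)

Section Growth.
Variables (R : realType) (N : nat).
Local Notation C := (Cplx R).
Local Notation CN := 'rV[C]_N.
Implicit Types (u v : CN -> R) (x : CN).

Definition coord_sum x : R := \sum_k cabs (x 0 k).

Lemma coord_sum_ge0 x : 0 <= coord_sum x.
Proof. by apply: sumr_ge0 => k _; exact: cabs_ge0. Qed.

(** The exponent is global, so that on all lines the growth is bounded with the same
    degree. *)
Definition tempered u : Prop :=
  (forall x, 0 <= u x) /\
  exists (D : nat) (K : R), forall x, u x <= K * (1 + coord_sum x) ^+ D.

Lemma tempered_cst (K : R) : 0 <= K -> tempered (fun=> K).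
Proof. by move=> K0; split=> //; exists 0%N, K => x; rewrite expr0 mulr1. Qed.

Lemma temperedD u v : tempered u -> tempered v -> tempered (fun x => u x + v x).
Proof.
move=> [u0 [D [K uK]]] [v0 [D' [K' vK']]]; split=> [x|]; first exact: addr_ge0.
have ge1 x : 1 <= 1 + coord_sum x by rewrite lerDl coord_sum_ge0.
have K_ge0 : 0 <= K.
  have := le_trans (u0 0) (uK 0); rewrite pmulr_lge0 // exprn_gt0 //.
  by apply: lt_le_trans (ge1 0).
have K'_ge0 : 0 <= K'.
  have := le_trans (v0 0) (vK' 0); rewrite pmulr_lge0 // exprn_gt0 //.
  by apply: lt_le_trans (ge1 0).
exists (maxn D D'), (K + K') => x; rewrite mulrDl.
apply: lerD; [apply: le_trans (uK x) _|apply: le_trans (vK' x) _]; rewrite ler_wpM2l //.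
  by apply: ler_weXn2l => //; exact: leq_maxl.
by apply: ler_weXn2l => //; exact: leq_maxr.
Qed.

Lemma temperedM u v : tempered u -> tempered v -> tempered (fun x => u x * v x).
Proof.
move=> [u0 [D [K uK]]] [v0 [D' [K' vK']]]; split=> [x|]; first exact: mulr_ge0.
exists (D + D')%N, (K * K') => x; rewrite exprD mulrACA.
exact: ler_pM.
Qed.

Lemma temperedX u d : tempered u -> tempered (fun x => u x ^+ d).
Proof.
move=> ut; elim: d => [|d IHd].
  by under [X in tempered X]eq_fun do rewrite expr0; exact: tempered_cst.
by under [X in tempered X]eq_fun do rewrite exprS; exact: temperedM.
Qed.

Lemma tempered_le u v : (forall x, 0 <= u x) -> (forall x, u x <= v x) ->
  tempered v -> tempered u.
Proof.
move=> u0 uv [_ [D [K vK]]]; split=> //; exists D, K => x.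
exact: le_trans (vK x).
Qed.

Lemma tempered_sum I (r : seq I) (F : I -> CN -> R) :
  (forall i, tempered (F i)) -> tempered (fun x => \sum_(i <- r) F i x).
Proof.
move=> Ft; elim: r => [|i r IHr].
  by under [X in tempered X]eq_fun do rewrite big_nil; exact: tempered_cst.
by under [X in tempered X]eq_fun do rewrite big_cons; exact: temperedD.
Qed.

Lemma tempered_meval (p : mpoly N C) : tempered (fun x => cabs (meval (x 0) p)).
Proof.
apply: (@meval_closed _ CN N (fun f => tempered (fun x => cabs (f x))) (fun x => x 0)).
- by move=> c; apply: tempered_cst; exact: cabs_ge0.
- move=> f g ft gt; apply: tempered_le (temperedD ft gt) => x; first exact: cabs_ge0.
  exact: cabsD.
- move=> f g ft gt; under [X in tempered X]eq_fun do rewrite cabsM.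
  exact: temperedM.
move=> k; split=> [x|]; first exact: cabs_ge0.
exists 1%N, 1 => x; rewrite mul1r expr1 /coord_sum (bigD1 k) //= addrCA lerDl.
by rewrite addr_ge0 // sumr_ge0 // => j _; exact: cabs_ge0.
Qed.

Lemma coord_sum_line x (k : 'I_N) (z : C) :
  coord_sum (x + z *: delta_mx 0 k) <= coord_sum x + cabs z.
Proof.
rewrite /coord_sum (bigD1 k) //= [in leRHS](bigD1 k) //=.
rewrite !mxE !eqxx mulr1 addrAC lerD ?cabsD //.
apply: ler_sum => j jk; rewrite !mxE [j == k]negbTE // andbF mulr0 addr0 //.
Qed.

Lemma tempered_line u : tempered u ->
  exists D : nat, forall x (k : 'I_N), exists K : R,
  forall z : C, u (x + z *: delta_mx 0 k) <= K * (1 + cabs z) ^+ D.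
Proof.
move=> [u0 [D [K uK]]]; exists D => x k; exists (K * (1 + coord_sum x) ^+ D) => z.
have K_ge0 : 0 <= K.
  have := le_trans (u0 0) (uK 0); rewrite pmulr_lge0 // exprn_gt0 //.
  by rewrite ltr_pwDl // coord_sum_ge0.
apply: le_trans (uK _) _; rewrite -mulrA ler_wpM2l // -exprMn.
have s0 := coord_sum_ge0 x; have z0 := cabs_ge0 z.
have s1 := coord_sum_ge0 (x + z *: delta_mx 0 k).
apply: lerXn2r; rewrite ?nnegrE ?addr_ge0 ?mulr_ge0 ?addr_ge0 //.
have := coord_sum_line x k z; have := mulr_ge0 s0 z0.
rewrite mulrDl mul1r mulrDr mulr1; lra.
Qed.
End Growth.

Section RootBound.
Variables (R : realType) (N : nat) (P : {poly mpoly N (Cplx R)}).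
Hypothesis P_gt1 : (1 < size P)%N.
Local Notation C := (Cplx R).
Local Notation CN := 'rV[C]_N.
Local Notation n := (size P).-1.

(** If [|y| <= 1] there is nothing to prove; otherwise the equation bounds the leading
    term by the others, whose powers of [y] are at most [|y|^(n-1)]. *)
Lemma root_bound x (y : C) : ~ Sigma P x -> (equation_at P x).[y] = 0 ->
  cabs (leading P x) * cabs y <= \sum_(k < size P) cabs (meval (x 0) P`_k).
Proof.
move=> Sx.
have [m Pm] : exists m, size P = m.+2.
  by exists (size P).-2; case: (size P) P_gt1 => [|[|]].
rewrite (@horner_coef_wide _ (size P)) ?size_equation_at //.
have coefE k : (equation_at P x)`_k = meval (x 0) P`_k by rewrite coef_map.
have leadE : meval (x 0) P`_m.+1 = leading P x by rewrite /leading /lead_coef Pm.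
rewrite Pm big_ord_recr /= coefE leadE => /eqP; rewrite addrC addr_eq0 => /eqP y0.
rewrite [leRHS]big_ord_recr /= leadE.
have sum_ge0 : 0 <= \sum_(k < m.+1) cabs (meval (x 0) P`_k).
  by apply: sumr_ge0 => k _; exact: cabs_ge0.
have [y1|/ltW y1] := leP (cabs y) 1.
  by rewrite (@le_trans _ _ (cabs (leading P x))) ?ler_piMr ?cabs_ge0 // lerDr.
have ym : 0 < cabs y ^+ m by rewrite exprn_gt0 //; apply: lt_le_trans y1.
apply: (@le_trans _ _ (\sum_(k < m.+1) cabs (meval (x 0) P`_k))); last first.
  by rewrite lerDl cabs_ge0.
rewrite -(ler_pM2r ym).
have -> : cabs (leading P x) * cabs y * cabs y ^+ m =
    cabs (\sum_(i < m.+1) (equation_at P x)`_i * y ^+ i).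
  by rewrite -mulrA -exprS -[RHS]cabsN -y0 cabsM cabsX.
apply: le_trans (cabs_sum _ _) _; rewrite mulr_suml; apply: ler_sum => k _.
rewrite coefE cabsM cabsX ler_wpM2l ?cabs_ge0 // ler_weXn2l //.
by rewrite -ltnS.
Qed.

(** Each occurrence of a root is compensated by one factor of the leading coefficient;
    sums are brought to a common power of it. *)
Lemma root_expression_bound (Phi : mpoly n C) : exists (d : nat) (u : CN -> R),
  tempered u /\ forall x eta, ~ Sigma P x -> enumerates_roots P x eta ->
    cabs (leading P x ^+ d * meval eta Phi) <= u x.
Proof.
pose T := {p : CN * ('I_n -> C) | ~ Sigma P p.1 /\ enumerates_roots P p.1 p.2}.
pose Q (f : T -> C) := exists (d : nat) (u : CN -> R), tempered u /\
  forall t : T, cabs (leading P (sval t).1 ^+ d * f t) <= u (sval t).1.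
suff [d [u [ut fu]]] : Q (fun t => meval (sval t).2 Phi).
  exists d, u; split=> // x eta Sx etaP.
  exact: (fu (exist _ (x, eta) (conj Sx etaP))).
have lead_t d : tempered (fun x => cabs (leading P x) ^+ d).
  by apply: temperedX; exact: tempered_meval.
apply: meval_closed => [c|f g [d [u [ut fu]]] [d' [u' [ut' gu]]]|f g [d [u [ut fu]]] [d' [u' [ut' gu]]]|i].
- exists 0%N, (fun=> cabs c); split; first by apply: tempered_cst; exact: cabs_ge0.
  by move=> t; rewrite expr0 mul1r.
- exists (d + d')%N, (fun x =>
  cabs (leading P x) ^+ d' * u x + cabs (leading P x) ^+ d * u' x).
  split; first by apply: temperedD; apply: temperedM.
  move=> t; set c := leading P _.
  have -> : c ^+ (d + d') * (f t + g t) = c ^+ d' * (c ^+ d * f t) + c ^+ d * (c ^+ d' * g t).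
    by rewrite exprD; ring.
  have cb k (b : C) (B : R) : cabs b <= B -> cabs (c ^+ k * b) <= cabs c ^+ k * B.
    by move=> bB; rewrite cabsM cabsX ler_wpM2l // exprn_ge0 // cabs_ge0.
  apply: le_trans (cabsD _ _) _; apply: lerD; apply: cb; [exact: fu|exact: gu].
- exists (d + d')%N, (fun x => u x * u' x); split; first exact: temperedM.
  move=> t; rewrite exprD mulrACA cabsM.
  by apply: ler_pM; rewrite ?cabs_ge0.
exists 1%N, (fun x => \sum_(k < size P) cabs (meval (x 0) P`_k)); split.
  by apply: tempered_sum => k; exact: tempered_meval.
case=> -[x eta] /= [Sx etaP]; rewrite expr1 cabsM.
by apply: root_bound => //; exact: enumerates_root etaP.
Qed.
End RootBound.

(** * Expansions of the roots along lines *)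

Section TaylorAlongLines.
Variables (R : realType) (N : nat) (P : {poly mpoly N (Cplx R)}).
Hypothesis P_gt1 : (1 < size P)%N.
Local Notation C := (Cplx R).
Local Notation CN := 'rV[C]_N.
Local Notation n := (size P).-1.
Implicit Types (x v : CN).

Lemma taylor_line k x v (j : 'I_N) : taylor k (fun w : C => (x + w *: v) 0 j).
Proof.
under [X in taylor k X]eq_fun do rewrite !mxE.
apply: taylorD; first exact: taylor_cst.
by apply: taylorM; [exact: taylor_id|exact: taylor_cst].
Qed.

Lemma taylor_meval_line k x v (p : mpoly N C) :
  taylor k (fun w : C => meval ((x + w *: v) 0) p).
Proof.
apply: (@meval_closed _ C N (taylor k) (fun w => (x + w *: v) 0)).
- exact: taylor_cst.
- exact: taylorD.
- exact: taylorM.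
- by move=> j; exact: taylor_line.
Qed.

Lemma taylor_equation_line k x v (y : C) :
  taylor k (fun w : C => (equation_at P (x + w *: v)).[y]).
Proof.
apply: (@horner_mpoly_closed _ C N (taylor k) (fun w => (x + w *: v) 0) (fun=> y)).
- exact: taylor_cst.
- exact: taylorD.
- exact: taylorM.
- by move=> j; exact: taylor_line.
- exact: taylor_cst.
Qed.

Lemma near_line x v (Q : CN -> Prop) :
  (\forall y \near x, Q y) -> \forall w \near (0 : C), Q (x + w *: v).
Proof.
move=> /(nbhs_ballP x _).1[_ /gt0_toC[r r_gt0 ->] xQ]; apply/near_cabsP.
pose m := cabs `|v|.
have m_gt0 : 0 < m + 1 by rewrite ltr_wpDl ?cabs_ge0.
exists (r / (m + 1)) => [|w]; first exact: divr_gt0.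
rewrite subr0 ltr_pdivlMr // => wr; apply: xQ.
rewrite -ball_normE /= opprD addrA subrr sub0r normrN normrZ normC_cabs.
have -> : `|v| = toC m by rewrite -normC_cabs normr_id.
rewrite -toCM ltc_toC.
by apply: le_lt_trans wr; rewrite ler_wpM2l ?cabs_ge0 // lerDl.
Qed.

Lemma continuous_line (f : CN -> C) x v :
  f @ x --> f x -> continuous0 (fun w : C => f (x + w *: v)).
Proof.
move=> fx; apply/continuous_cabsP => e e_gt0; rewrite scale0r addr0.
exact: (near_line v (cvg_near_cabs fx e_gt0)).
Qed.

(** The formula for the increment of a root expresses it through the roots
    themselves, with one more factor [w]: each expansion yields the next one. *)
Lemma taylor_chart k c e h x v i : root_chart P c e h -> ball c e x ->
  taylor k (fun w : C => h i (x + w *: v)).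
Proof.
move=> hC ex; have FF : Filter (nbhs (0 : C)) := nbhs_filter _.
have x0 : x + 0 *: v = x by rewrite scale0r addr0.
elim: k i => [|k IHk] i.
  apply: continuous_line; exact: (chart_continuous hC ex).
have [U kU UE] := taylor_equation_line k.+1 x v (h i x).
pose V (w : C) := (leading P (x + w *: v) *
  \prod_(j | j != i) (h i x - h j (x + w *: v)))^-1.
have kV : taylor k V.
  apply: taylorV.
    rewrite x0 mulf_neq0 ?(regular_leading (chart_regular hC ex)) //.
    apply/prodf_neq0 => j ji.
    by rewrite subr_eq0 (inj_eq (chart_roots hC ex).2) eq_sym.
  apply: taylorM; first exact: taylor_meval_line.
  apply: taylor_prod => j; apply: taylorD; first exact: taylor_cst.
  apply: taylor_eq (taylorM (taylor_cst k (-1)) (IHk j)).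
  by apply: filterE => w; rewrite mulN1r.
exists (fun w => -1 * (U w * V w)).
  by apply: taylorM (taylorM kU kV); exact: taylor_cst.
have near_x := near_line v
  (@filterI _ _ (nbhs_filter x) _ _ (near_in_ball ex) (chart_other_roots i hC ex)).
apply: filterS2 UE near_x => w UE [ew ij0]; rewrite x0.
rewrite (root_increment (eta := h^~ x) (chart_regular hC ew) (chart_roots hC ew) ij0).
rewrite UE x0 (enumerates_root _ (chart_roots hC ex)) add0r -/(V w).
by ring.
Qed.
End TaylorAlongLines.

(** * Invariant expressions in the roots are rational *)

Section InvariantExpressions.
Variables (R : realType) (N : nat) (P : {poly mpoly N (Cplx R)}).
Hypothesis P_gt1 : (1 < size P)%N.
Local Notation C := (Cplx R).
Local Notation CN := 'rV[C]_N.
Local Notation n := (size P).-1.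

Lemma meval_msym (m : nat) (K : comNzRingType) (v : 'I_m -> K) (s : 'S_m) (p : mpoly m K) :
  meval v (msym s p) = meval (fun i => v (s i)) p.
Proof.
elim/mpolyind: p => [|a mm p _ _ IHp]; first by rewrite msym0 !meval0.
rewrite msymD msymZ !mevalD !mevalZ IHp msymX !mevalX; congr (_ * _ + _).
rewrite (reindex_inj (@perm_inj _ s)) /=; apply: eq_bigr => i _.
by rewrite mnmE permK.
Qed.

Variables (x0 : CN) (Y : 'I_n -> CN -> C) (Phi : mpoly n C).
Hypothesis Y_germ : forall i, germ_of_y P x0 (Y i).
Hypothesis Phi_invariant : forall s, s \in monodromy P x0 Y -> msym s Phi = Phi.

Let eta0 (i : 'I_n) : C := Y i x0.

(** Two labellings reached at [x] differ by a permutation [s]. Relabelling the first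
    continuation by [s] and going back along the second one leads from [eta0] relabelled
    by [s] to [eta0]: thus [s] is in the monodromy group. *)
Lemma linked_single_valued x eta zeta : linked P x0 eta0 x eta ->
  linked P x0 eta0 x zeta -> meval eta Phi = meval zeta Phi.
Proof.
move=> l1 l2.
have [s sE] := enumerations_permuted (linked_regular l1) (linked_enumerates l1) (linked_enumerates l2).
have zetaE : zeta = (fun i => eta (s i)) by apply/funext.
have := linked_perm s l1; rewrite -zetaE => l3.
have sG : s \in monodromy P x0 Y.
  apply: (linked_monodromy P_gt1 (eta := eta0)) => //.
  exact: linked_sym (linked_trans l3 (linked_sym l2)).
by rewrite zetaE -meval_msym (Phi_invariant sG).
Qed.

Variable d : nat.

(** The single-valued function defined by [Phi] on the points that can be linked to
    [x0]. These points are open and closed among the regular ones, so the extension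
    by [0] elsewhere is as regular as the function itself. *)
Definition continued_value x : C :=
  xget 0 [set y | exists2 eta, linked P x0 eta0 x eta & y = leading P x ^+ d * meval eta Phi].

Lemma continued_valueE x eta : linked P x0 eta0 x eta ->
  continued_value x = leading P x ^+ d * meval eta Phi.
Proof.
move=> l; rewrite /continued_value; case: xgetP => [_ _ [zeta l' ->]|].
  by rewrite (linked_single_valued l l').
by move/(_ (leading P x ^+ d * meval eta Phi)); case; exists eta.
Qed.

Lemma continued_value_eq0 x : ~ (exists eta, linked P x0 eta0 x eta) ->
  continued_value x = 0.
Proof.
by move=> nl; rewrite /continued_value; case: xgetP => [y _ [eta l _]|//]; case: nl;
  exists eta.
Qed.

Lemma taylor_continued_value k x v : ~ Sigma P x ->
  taylor k (fun w : C => continued_value (x + w *: v)).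
Proof.
move=> Sx; have [e e_gt0 [h hC]] := root_chart_exists P_gt1 Sx.
have ex : ball x e x by exact: ballxx.
have near_x := near_line v (near_in_ball ex).
have [[eta l]|nl] := pselect (exists eta, linked P x0 eta0 x eta).
  have [g gC gx] := root_chart_through hC ex (linked_enumerates l).
  have etaE : eta = g^~ x by apply/funext => i; rewrite gx.
  rewrite etaE in l.
  apply: (@taylor_eq _ k (fun w : C => leading P (x + w *: v) ^+ d *
      meval (fun i => g i (x + w *: v)) Phi)).
    by apply: filterS near_x => w ew; rewrite (continued_valueE (linked_chart gC ex l ew)).
  apply: taylorM; first by apply: taylorX; exact: taylor_meval_line.
  apply: (@meval_closed _ C n (taylor k) (fun w i => g i (x + w *: v))).
  - exact: taylor_cst.
  - exact: taylorD.
  - exact: taylorM.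
  - by move=> i; exact: taylor_chart gC ex.
apply: taylor_eq (taylor_cst k 0); apply: filterS near_x => w ew.
rewrite continued_value_eq0 // => -[eta l]; apply: nl.
have [g gC gx] := root_chart_through hC ew (linked_enumerates l).
have etaE : eta = g^~ (x + w *: v) by apply/funext => i; rewrite gx.
rewrite etaE in l; exists (g^~ x); exact: (linked_chart gC ew l ex).
Qed.

Lemma singular_points_on_line x v : ~ Sigma P x -> exists S : seq C,
  forall z : C, z \notin S <-> ~ Sigma P (x + z *: v).
Proof.
move=> Sx.
have [q qE] : exists q : {poly C}, forall z, meval ((x + z *: v) 0) (lead_coef P * discriminant P) = q.[z].
  apply: (@meval_closed _ C N (fun f => exists q : {poly C}, forall z, f z = q.[z])
    (fun z => (x + z *: v) 0)) => [c|f g [p pE] [q qE]|f g [p pE] [q qE]|j].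
  - by exists c%:P => z; rewrite hornerC.
  - by exists (p + q) => z; rewrite hornerD pE qE.
  - by exists (p * q) => z; rewrite hornerM pE qE.
  - by exists ((x 0 j)%:P + (v 0 j)%:P * 'X) => z; rewrite !mxE !hornerE mulrC.
have [r rE] := closed_field_poly_normal q.
have q0 : q != 0.
  apply/negP => /eqP q0; apply: Sx; rewrite /Sigma /=.
  by have := qE 0; rewrite scale0r addr0 q0 horner0.
exists r => z; rewrite /Sigma /= qE rE hornerZ.
split=> [zr /eqP|qz].
  by rewrite mulf_eq0 lead_coef_eq0 (negbTE q0) /= -rootE root_prod_XsubC (negbTE zr).
apply/negP => zr; apply: qz; apply/eqP.
by rewrite mulf_eq0 -[X in _ || X]rootE root_prod_XsubC zr orbT.
Qed.

Lemma polynomial_on_lines (u : CN -> R) : tempered u ->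
  (forall x eta, ~ Sigma P x -> enumerates_roots P x eta ->
     cabs (leading P x ^+ d * meval eta Phi) <= u x) ->
  exists D : nat, forall x k, ~ Sigma P x ->
    exists2 q : {poly C}, (size q <= D)%N &
      forall z, ~ Sigma P (x + z *: delta_mx 0 k) ->
        continued_value (x + z *: delta_mx 0 k) = q.[z].
Proof.
move=> ut bound; have [D uD] := tempered_line ut; exists D.+1 => x k Sx.
have [S SP] := singular_points_on_line (delta_mx 0 k) Sx.
have [K uK] := uD x k.
have [|z zS|q sq qE] := @polynomial_of_growth _ D.+1
  (fun z => continued_value (x + z *: delta_mx 0 k)) S K.
- move=> z /SP Sz; apply: taylor_eq (taylor_continued_value 2 (delta_mx 0 k) Sz).
  by apply: filterE => w; rewrite scalerDl addrA.
- rewrite exprSr mulrA ler_wpM2r ?addr_ge0 ?cabs_ge0 //; apply: le_trans (uK z).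
  have [[eta l]|nl] := pselect (exists eta, linked P x0 eta0 (x + z *: delta_mx 0 k) eta).
    rewrite (continued_valueE l).
    exact: bound (linked_regular l) (linked_enumerates l).
  by rewrite continued_value_eq0 // cabs0; exact: ut.1.
by exists q => // z /SP; exact: qE.
Qed.
End InvariantExpressions.

Section Rationality.
Variables (R : realType) (N : nat) (P : {poly mpoly N (Cplx R)}).
Hypothesis P_gt1 : (1 < size P)%N.
Local Notation C := (Cplx R).
Local Notation CN := 'rV[C]_N.
Local Notation n := (size P).-1.

Lemma polydisc_in_ball (x0 x : CN) (r : R) : 0 < r ->
  (forall k, cabs (x 0 k - x0 0 k) < r) -> ball x0 (toC r) x.
Proof.
move=> r_gt0 xr; split=> [|i j]; first by rewrite -toC0 ltc_toC.
rewrite (ord1 i) -ball_normE /= distrC normC_cabs ltc_toC.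
exact: xr.
Qed.

(** Multiplied by a power of the leading coefficient, the continued value of [Phi] is a
    polynomial on every coordinate line, of bounded degree; on a polydisc around [x0] it
    is therefore a polynomial. *)
Lemma invariant_rational_germ (x0 : CN) (Y : 'I_n -> CN -> C) (Phi : mpoly n C) :
  ~ Sigma P x0 -> (forall i, germ_of_y P x0 (Y i)) -> injective (fun i => Y i x0) ->
  (forall s, s \in monodromy P x0 Y -> msym s Phi = Phi) ->
  rational_germ x0 (fun x => meval (fun i => Y i x) Phi).
Proof.
move=> Sx0 Yy Y_inj Phi_inv.
have [d [u [ut bound]]] := root_expression_bound P_gt1 Phi.
have [D lines] := polynomial_on_lines P_gt1 Yy Phi_inv ut bound.
pose F := continued_value x0 Y Phi d.
have eta0P : enumerates_roots P x0 (fun i => Y i x0).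
  by apply: distinct_roots_enumerate => // i; exact: germ_of_y_root (Yy i).
have [_ /gt0_toC[r r_gt0 ->] [h hC]] := root_chart_exists P_gt1 Sx0.
have ex0 : ball x0 (toC r) x0 by apply: ballxx; rewrite -toC0 ltc_toC.
have [g gC gx0] := root_chart_through hC ex0 eta0P.
have l0 : linked P x0 (fun i => Y i x0) x0 (g^~ x0).
  by have -> : g^~ x0 = (fun i => Y i x0); [apply/funext => i;
    rewrite gx0|exact: linked_refl].
pose in_disc (k : 'I_N) (a : C) : Prop := cabs (a - x0 0 k) < r.
have disc_ball (x : CN) : (forall k, in_disc k (x 0 k)) -> ball x0 (toC r) x.
  exact: polydisc_in_ball.
have FE (x : CN) : ball x0 (toC r) x -> F x = leading P x ^+ d * meval (g^~ x) Phi.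
  move=> ex; apply: continued_valueE => //; exact: (linked_chart gC ex0 l0 ex).
pose node (k : 'I_N) (j : nat) := x0 0 k + toC (r / j.+2%:R).
have node_in k j : in_disc k (node k j).
  rewrite /in_disc /node addrC addKr cabs_toC ger0_norm ?divr_ge0 // ?(ltW r_gt0) //.
  by rewrite ltr_pdivrMr // ltr_pMr // ltr1n.
have node_inj k : injective (node k).
  move=> i j /addrI/toC_inj/(mulfI (lt0r_neq0 r_gt0))/invr_inj/eqP.
  by rewrite eqr_nat => /eqP[].
have [p pF] : exists p : mpoly N C,
    forall x : CN, (forall k, in_disc k (x 0 k)) -> F x = meval (x 0) p.
  apply: (@separately_polynomial C N in_disc node node_in node_inj D F) => x k xI.
  have [q sq qE] := lines x k (chart_regular gC (disc_ball _ xI)).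
  exists (q \Po ('X - (x 0 k)%:P)) => [|a ka]; first by rewrite size_comp_poly2 ?size_XsubC.
  have updE : update x k a = x + (a - x 0 k) *: delta_mx 0 k.
    apply/rowP => j; rewrite !mxE eqxx /=; case: eqP => [->|_].
      by rewrite mulr1 addrC subrK.
    by rewrite mulr0 addr0.
  rewrite horner_comp hornerXsubC updE; apply: qE; rewrite -updE.
  apply: (chart_regular gC); apply: disc_ball => j; rewrite mxE.
  by case: eqP => [->|_] //; exact: xI.
have lead0 := regular_leading Sx0.
exists p, (lead_coef P ^+ d); split; first by rewrite rmorphXn expf_neq0.
have near_disc : \forall x \near x0, forall k, in_disc k ((x : CN) 0 k).
  apply: (@filter_forall CN 'I_N _ (nbhs x0) (nbhs_filter x0)) => k.
  exact: (cvg_near_cabs (differentiable_continuous (differentiable_coord x0 0 k)) r_gt0).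
have near_Y : \forall x \near x0, forall i, Y i x = g i x.
  apply: (@filter_forall CN 'I_n _ (nbhs x0) (nbhs_filter x0)) => i.
  by apply: (germ_of_y_unique P_gt1 Sx0 (Yy i) (chart_germ i gC ex0)); rewrite gx0.
apply: filterS2 near_disc near_Y => x xI Yx.
have ex := disc_ball _ xI.
have -> : (fun i => Y i x) = g^~ x by apply/funext => i; exact: Yx.
rewrite -pF // FE // rmorphXn /= -/(leading P x) mulrC mulKf //.
by rewrite expf_neq0 // regular_leading //; exact: (chart_regular gC).
Qed.
End Rationality.

(** * Sequences of root extractions and summations *)

Section RadicalChains.
Variables (A : pzRingType) (B : A -> Prop).

Definition radical_chain (l : seq A) : Prop := forall i, (i < size l)%N ->
  [\/ B l`_i,
      exists j k, [/\ (j < i)%N, (k < i)%N & l`_i = l`_j + l`_k] |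
      exists j q, [/\ (j < i)%N, (0 < q)%N & l`_i ^+ q = l`_j]].

Lemma radical_chain_cat l1 l2 :
  radical_chain l1 -> radical_chain l2 -> radical_chain (l1 ++ l2).
Proof.
move=> c1 c2 i; rewrite size_cat nth_cat => il; case: ltnP => [i1|i1].
  have nth1 j : (j < i)%N -> (l1 ++ l2)`_j = l1`_j.
    by move=> ji; rewrite nth_cat (ltn_trans ji i1).
  have [Bi|[j [k [ji ki E]]]|[j [q [ji q0 E]]]] := c1 i i1; first by constructor 1.
    by constructor 2; exists j, k; rewrite !nth1.
  by constructor 3; exists j, q; rewrite !nth1.
have i2 : (i - size l1 < size l2)%N by rewrite ltn_subLR.
have lt2 j : (j < i - size l1)%N -> (size l1 + j < i)%N by rewrite ltn_subRL.
have nth2 j : (l1 ++ l2)`_(size l1 + j) = l2`_j.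
  by rewrite nth_cat ltnNge leq_addr /= addKn.
have [Bi|[j [k [ji ki E]]]|[j [q [ji q0 E]]]] := c2 _ i2; first by constructor 1.
  by constructor 2; exists (size l1 + j)%N, (size l1 + k)%N; rewrite !nth2; split=> //;
    exact: lt2.
by constructor 3; exists (size l1 + j)%N, q; rewrite !nth2; split=> //; exact: lt2.
Qed.

Lemma radical_chain_rcons l a : radical_chain l ->
  [\/ B a,
      exists j k, [/\ (j < size l)%N, (k < size l)%N & a = l`_j + l`_k] |
      exists j q, [/\ (j < size l)%N, (0 < q)%N & a ^+ q = l`_j]] ->
  radical_chain (rcons l a).
Proof.
move=> cl ca i; rewrite size_rcons ltnS leq_eqVlt => /orP[/eqP ->|il].
  have nthl j : (j < size l)%N -> (rcons l a)`_j = l`_j by move=> jl; rewrite nth_rcons jl.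
  rewrite nth_rcons ltnn eqxx.
  case: ca => [Ba|[j [k [jl kl E]]]|[j [q [jl q0 E]]]]; first by constructor 1.
    by constructor 2; exists j, k; rewrite !nthl.
  by constructor 3; exists j, q; rewrite !nthl.
have nthl j : (j < i)%N -> (rcons l a)`_j = l`_j.
  by move=> ji; rewrite nth_rcons (ltn_trans ji il).
rewrite nth_rcons il; have [Bi|[j [k [ji ki E]]]|[j [q [ji q0 E]]]] := cl i il.
- by constructor 1.
- by constructor 2; exists j, k; rewrite !nthl.
- by constructor 3; exists j, q; rewrite !nthl.
Qed.

Lemma radical_closure_chain a : radical_closure B a ->
  exists l, radical_chain (rcons l a).
Proof.
elim=> [{}a Ba|{}a b _ [la ca] _ [lb cb]|q {}a q_gt0 _ [l cl]].
- by exists [::]; apply: radical_chain_rcons => [i //|]; constructor 1.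
- exists (rcons la a ++ rcons lb b).
  apply: radical_chain_rcons; first exact: radical_chain_cat.
  constructor 2; exists (size la), ((size la).+1 + size lb)%N.
  have -> : (rcons la a ++ rcons lb b)`_(size la) = a.
    by rewrite nth_cat size_rcons ltnSn nth_rcons ltnn eqxx.
  have -> : (rcons la a ++ rcons lb b)`_((size la).+1 + size lb) = b.
    by rewrite nth_cat size_rcons ltnNge leq_addr /= addKn nth_rcons ltnn eqxx.
  by split=> //; rewrite size_cat !size_rcons; lia.
- exists (rcons l (a ^+ q)); apply: radical_chain_rcons => //; constructor 3.
  by exists (size l), q; rewrite size_rcons nth_rcons ltnn eqxx.
Qed.
End RadicalChains.

Lemma differentiable_meval_family (R : realType) (N m : nat)
    (Y : 'I_m -> 'rV[Cplx R]_N -> Cplx R) (p : mpoly m (Cplx R)) (x : 'rV[Cplx R]_N) :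
  (forall j, differentiable (Y j) x) ->
  differentiable (fun y : 'rV[Cplx R]_N => meval (fun j => Y j y) p) x.
Proof.
move=> dY.
apply: (@meval_closed (Cplx R) 'rV[Cplx R]_N m (fun f => differentiable f x) (fun y j =>
  Y j y)).
- by move=> c; exact: differentiable_cst.
- by move=> f g; exact: differentiableD.
- by move=> f g; exact: differentiableM.
- exact: dY.
Qed.

Theorem theorem10 (R : realType) (N : nat) (P : {poly mpoly N (Cplx R)})
    (irrP : algebraic_equation P)
    (x0 : 'rV[Cplx R]_N) (x0_regular : ~ Sigma P x0)
    (Y : 'I_(size P).-1 -> 'rV[Cplx R]_N -> Cplx R) (allY : all_germs P x0 Y)
    (solvable_monodromy : solvable (monodromy P x0 Y)) :
  representable_by_radicals P.
Proof.
have [Yy Y_distinct _] := allY.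
have P_neq0 : P != 0.
  apply/negP => /eqP P0; apply: x0_regular.
  by rewrite /Sigma /= P0 lead_coef0 mul0r meval0.
have P_gt1 : (1 < size P)%N.
  have sE : size (map_poly (@tofrac (mpoly N (Cplx R))) P) = size P.
    by rewrite size_map_poly_id0 // tofrac_eq0 lead_coef_eq0.
  have [+ _] := irrP; rewrite sE.
  by case: (size P) (size_poly_eq0 P) => [|[|]] // /esym; rewrite eqxx (negbTE P_neq0).
have Y_inj : injective (fun i => Y i x0).
  by move=> i j ij; apply: Y_distinct; exact: (germ_of_y_unique P_gt1 x0_regular (Yy i) (Yy j) ij).
pose ev (Phi : mpoly (size P).-1 (Cplx R)) (x : 'rV[Cplx R]_N) := meval (fun i => Y i x) Phi.
pose G := Group (monodromy_group_set x0_regular allY).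
have i0 : 'I_(size P).-1 by apply: (@Ordinal _ 0); rewrite -ltnS prednK // ltnW.
pose act (s : 'S_(size P).-1) :
  {lrmorphism mpoly (size P).-1 (Cplx R) -> mpoly (size P).-1 (Cplx R)} := msym s.
have act1 a : act 1%g a = a by exact: msym1m.
have actM s t a : act (s * t)%g a = act t (act s a) by exact: msymMm.
have [l cl] := radical_closure_chain
  (solvable_descent act1 actM (G := G) (mpolyX _ (mnm1 i0)) solvable_monodromy).
set a := mpolyX _ _ in cl.
exists x0, (size l), (fun i x => ev (rcons l a)`_i x); split; last first.
  rewrite /= nth_rcons ltnn eqxx.
  have -> : ev a = Y i0 by apply/funext => x; rewrite /ev mevalXU.
  exact: Yy.
move=> i; split.
  have near_Y : \forall x \near x0, forall j, differentiable (Y j) x.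
    apply: (@filter_forall _ _ _ (nbhs x0) (nbhs_filter x0)) => j.
    by have [] := Yy j.
  apply: filterS near_Y => x dY.
  exact: (differentiable_meval_family (rcons l a)`_i dY).
have il : (i < size (rcons l a))%N by rewrite size_rcons.
have sl j : (j < i)%N -> (j < (size l).+1)%N by move=> ji; exact: ltn_trans (ltn_ord i).
have [Bi|[j [k [ji ki E]]]|[j [q [ji q0 E]]]] := cl _ il.
- constructor 1; apply: invariant_rational_germ => // s sG; exact: Bi.
- constructor 2; exists (Ordinal (sl _ ji)), (Ordinal (sl _ ki)); split=> //.
  by apply: filterE => x; rewrite /ev E mevalD.
constructor 3; exists (Ordinal (sl _ ji)), q; split=> //.
by apply: filterE => x; rewrite /ev /= -E rmorphXn.
Qed.
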